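(* If a Turing degree $\mathbf d$ is uniformly high for descending sequences and $\mathbf b$ is PA over $\mathbf d$, then $\mathbf b$ is uniformly high for isomorphism.
   Context: Let $(\mathcal L_e)_{e\in\omega}$ be an effective listing of the computable linear orders (with domain a subset of $\omega$) and $(\mathcal M_i)_{i\in\omega}$ an effective listing of all computable structures. A degree $\mathbf d$ is uniformly high for descending sequences if there are $D\in\mathbf d$ and a total computable $f$ such that for every $e$ with $\mathcal L_e$ ill-founded, $\{f(e)\}^D$ is an infinite descending sequence in $\mathcal L_e$. A degree $\mathbf d$ is uniformly high for isomorphism if there are $D\in\mathbf d$ and a total computable $f$ such that whenever $\mathcal M_i\cong\mathcal M_j$, $\{f(i,j)\}^D$ is an isomorphism from $\mathcal M_i$ to $\mathcal M_j$. $\mathbf b$ is PA over $\mathbf d$ if $\mathbf b$ computes a member of every nonempty $\Pi^0_1(\mathbf d)$ class in $2^\omega$. *)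

(* Defs.v *)
From mathcomp Require Import all_boot.
From Stdlib Require Cantor List.

Set Implicit Arguments.
Unset Strict Implicit.
Unset Printing Implicit Defensive.

(* Subsets of omega, i.e. points of 2^omega. *)
Notation cantor := (nat -> bool).

Definition cpair (x y : nat) : nat := Cantor.to_nat (x, y).
Definition cfst (n : nat) : nat := (Cantor.of_nat n).1.
Definition csnd (n : nat) : nat := (Cantor.of_nat n).2.

Lemma cfst_pair x y : cfst (cpair x y) = x.
Proof. by rewrite /cfst /cpair Cantor.cancel_of_to. Qed.

Lemma csnd_pair x y : csnd (cpair x y) = y.
Proof. by rewrite /csnd /cpair Cantor.cancel_of_to. Qed.

Lemma cpair_inj x y x' y' : cpair x y = cpair x' y' -> x = x' /\ y = y'.
Proof.
move=> E; split.
  by have := congr1 cfst E; rewrite !cfst_pair.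
by have := congr1 csnd E; rewrite !csnd_pair.
Qed.

Fixpoint seqcode (s : seq nat) : nat :=
  if s is x :: s' then (cpair x (seqcode s')).+1 else 0.

Lemma seqcode_inj : injective seqcode.
Proof.
by elim=> [|x s IH] [|y t] //= [] /cpair_inj [-> /IH ->].
Qed.

(* Kleene's partial recursive functions relative to an oracle, in unary form:
   several arguments are passed through the pairing function. *)
Inductive prog : Type :=
  | Zero | Succ | Fst | Snd | Oracle
  | Pair of prog & prog
  | Comp of prog & prog
  | Prec of prog & prog
  | Mu of prog.

(* [eval A p x y] : the program p with oracle A halts on x with output y. *)
Inductive eval (A : cantor) : prog -> nat -> nat -> Prop :=
  | ev_zero x : eval A Zero x 0
  | ev_succ x : eval A Succ x x.+1
  | ev_fst x : eval A Fst x (cfst x)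
  | ev_snd x : eval A Snd x (csnd x)
  | ev_oracle x : eval A Oracle x (A x)
  | ev_pair p q x y z :
      eval A p x y -> eval A q x z -> eval A (Pair p q) x (cpair y z)
  | ev_comp p q x y z :
      eval A q x y -> eval A p y z -> eval A (Comp p q) x z
  | ev_prec0 p q a y :
      eval A p a y -> eval A (Prec p q) (cpair a 0) y
  | ev_precS p q a n y z :
      eval A (Prec p q) (cpair a n) y ->
      eval A q (cpair a (cpair n y)) z ->
      eval A (Prec p q) (cpair a n.+1) z
  | ev_mu p a n (w : nat -> nat) :
      (forall m, m < n -> eval A p (cpair a m) (w m).+1) ->
      eval A p (cpair a n) 0 ->
      eval A (Mu p) a n.

Fixpoint progcode (p : prog) : nat :=
  match p with
  | Zero => cpair 0 0
  | Succ => cpair 1 0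
  | Fst => cpair 2 0
  | Snd => cpair 3 0
  | Oracle => cpair 4 0
  | Pair p q => cpair 5 (cpair (progcode p) (progcode q))
  | Comp p q => cpair 6 (cpair (progcode p) (progcode q))
  | Prec p q => cpair 7 (cpair (progcode p) (progcode q))
  | Mu p => cpair 8 (progcode p)
  end.

(* [phi A e] is the graph of the partial function {e}^A; it is empty when e is
   not the code of a program. *)
Definition phi (A : cantor) (e x y : nat) : Prop :=
  exists2 p, progcode p = e & eval A p x y.

Lemma progcode_inj : injective progcode.
Proof.
elim=> [|||||p IHp q IHq|p IHp q IHq|p IHp q IHq|p IHp]
       [|||||p' q'|p' q'|p' q'|p'] //= /cpair_inj [] // _.
- by case/cpair_inj=> /IHp-> /IHq->.
- by case/cpair_inj=> /IHp-> /IHq->.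
- by case/cpair_inj=> /IHp-> /IHq->.
- by move/IHp->.
Qed.

Lemma eval_prec_inv A p q x z : eval A (Prec p q) x z ->
  (exists2 a, x = cpair a 0 & eval A p a z) \/
  (exists a n y, [/\ x = cpair a n.+1, eval A (Prec p q) (cpair a n) y
                   & eval A q (cpair a (cpair n y)) z]).
Proof.
move=> E; inversion E; subst; first by left; exists a.
by right; exists a, n, y.
Qed.

Lemma eval_det A p x y z : eval A p x y -> eval A p x z -> y = z.
Proof.
move=> E; elim: E z => {p x y}.
- by move=> x z E; inversion E.
- by move=> x z E; inversion E.
- by move=> x z E; inversion E.
- by move=> x z E; inversion E.
- by move=> x z E; inversion E.
- move=> p q x y y' _ IHp _ IHq z E; inversion E; subst.
  by congr cpair; [apply: IHp | apply: IHq].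
- move=> p q x y y' _ IHq _ IHp z E; inversion E; subst.
  have Ey : y = y0 by apply: IHq.
  by apply: IHp; rewrite Ey.
- move=> p q a y _ IHp z /eval_prec_inv [[a' /cpair_inj [<- _]]|].
    exact: IHp.
  by case=> [a' [n [y' [/cpair_inj []]]]].
- move=> p q a n y y' _ IH1 _ IH2 z /eval_prec_inv [[a' /cpair_inj []]|] //.
  case=> [a' [n' [y0 [/cpair_inj [<- [<-]] /IH1 <-]]]].
  exact: IH2.
- move=> p a n w _ IHw _ IH0 z E; inversion E as [| | | | | | | | |? ? ? w' Hw H0].
  subst; case: (ltngtP n z) => // lt.
    by have := IH0 _ (Hw _ lt).
  by have := IHw _ lt _ H0.
Qed.

Lemma phi_det A e x y z : phi A e x y -> phi A e x z -> y = z.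
Proof.
by case=> p <- Ey [q /progcode_inj ->]; apply: eval_det.
Qed.

Definition computable_in (A : cantor) (f : nat -> nat) : Prop :=
  exists e, forall x, phi A e x (f x).

Definition emptyset : cantor := fun=> false.

Definition computable (f : nat -> nat) : Prop := computable_in emptyset f.

Definition turing_le (A B : cantor) : Prop :=
  computable_in B (fun x => nat_of_bool (A x)).

Definition turing_eq (A B : cantor) : Prop := turing_le A B /\ turing_le B A.

Record tdegree := TDegree {
  deg_mem :> cantor -> Prop;
  deg_memP : exists A, forall B, deg_mem B <-> turing_eq A B
}.

Definition deg_computes (b : tdegree) (X : cantor) : Prop :=
  exists2 B, b B & turing_le X B.

Definition tree (T : seq bool -> bool) : Prop :=
  forall s t, prefix s t -> T t -> T s.

Definition strcode (s : seq bool) : nat := seqcode (map nat_of_bool s).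

(* Pi^0_1(D) classes: sets of paths through D-computable binary trees. *)
Definition pi01_class (D : cantor) (P : cantor -> Prop) : Prop :=
  exists T : seq bool -> bool,
    [/\ tree T,
        exists e, forall s, phi D e (strcode s) (T s)
      & forall X, P X <-> forall n, T (mkseq X n)].

Definition PA_over (b d : tdegree) : Prop :=
  forall (D : cantor) (P : cantor -> Prop),
    d D -> pi01_class D P -> (exists X, P X) ->
    exists2 X, P X & deg_computes b X.

Record linorder := LinOrder {
  ldom : nat -> bool;
  lle : nat -> nat -> bool;
  lle_dom : forall x y, lle x y -> ldom x /\ ldom y;
  lle_refl : forall x, ldom x -> lle x x;
  lle_anti : forall x y, lle x y -> lle y x -> x = y;
  lle_trans : forall x y z, lle x y -> lle y z -> lle x z;
  lle_total : forall x y, ldom x -> ldom y -> lle x y \/ lle y x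
}.

Definition llt (L : linorder) (x y : nat) : Prop := lle L x y /\ x <> y.

Definition descending_seq (L : linorder) (g : nat -> nat) : Prop :=
  (forall n, ldom L (g n)) /\ (forall n, llt L (g n.+1) (g n)).

Definition ill_founded (L : linorder) : Prop := exists g, descending_seq L g.

(* [lo_listed e L] : L is the e-th computable linear order L_e, i.e. {e} is the
   characteristic function of its order relation (and hence of its domain, the
   set of x with x <= x).  If {e} is not such a function, L_e is undefined. *)
Definition lo_listed (e : nat) (L : linorder) : Prop :=
  forall x y, phi emptyset e (cpair x y) (lle L x y).

Definition unif_high_descending (d : tdegree) : Prop :=
  exists (D : cantor) (f : nat -> nat),
    [/\ d D, computable f
      & forall e L, lo_listed e L -> ill_founded L ->
          exists2 g, descending_seq L g & forall n, phi D (f e) n (g n)].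

(* Languages with relation symbols R_0, R_1, ... and function symbols
   F_0, F_1, ...; the arity is [None] for a symbol not in the language.
   Constants are 0-ary function symbols. *)
Record language := Language {
  rel_arity : nat -> option nat;
  fun_arity : nat -> option nat
}.

Definition same_language (K K' : language) : Prop :=
  rel_arity K =1 rel_arity K' /\ fun_arity K =1 fun_arity K'.

(* [srel] and [sfun] are meaningful only on tuples from the domain whose length
   is the arity of the symbol; other values are junk and never consulted. *)
Record structure := Structure {
  slang : language;
  sdom : nat -> bool;
  srel : nat -> seq nat -> bool;
  sfun : nat -> seq nat -> nat;
  sfun_dom : forall s xs,
    fun_arity slang s = Some (size xs) -> all sdom xs -> sdom (sfun s xs)
}.

(* [h] is the graph of a partial function on omega, of domain [sdom M]. *)
Definition isomorphism (h : nat -> nat -> Prop) (M N : structure) : Prop :=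
  [/\ same_language (slang M) (slang N),
      [/\ forall x y y', h x y -> h x y' -> y = y',
          forall x, sdom M x <-> exists y, h x y,
          forall y, sdom N y <-> exists x, h x y
        & forall x x' y, h x y -> h x' y -> x = x'],
      forall s xs ys, rel_arity (slang M) s = Some (size xs) ->
        List.Forall2 h xs ys -> srel M s xs = srel N s ys
    & forall s xs ys, fun_arity (slang M) s = Some (size xs) ->
        List.Forall2 h xs ys -> h (sfun M s xs) (sfun N s ys)].

Definition isomorphic (M N : structure) : Prop := exists h, isomorphism h M N.

Definition arity_code (a : option nat) : nat := if a is Some n then n.+1 else 0.

(* [st_listed i M] : M is the i-th computable structure M_i, i.e. {i} computes
   its domain, its language and its basic relations and functions.  If {i} does
   not compute a structure in this way, M_i is undefined. *)
Definition st_listed (i : nat) (M : structure) : Prop :=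
  [/\ forall x, phi emptyset i (cpair 0 x) (sdom M x),
      forall s, phi emptyset i (cpair 1 s) (arity_code (rel_arity (slang M) s)),
      forall s, phi emptyset i (cpair 2 s) (arity_code (fun_arity (slang M) s)),
      forall s xs,
        rel_arity (slang M) s = Some (size xs) -> all (sdom M) xs ->
        phi emptyset i (cpair 3 (cpair s (seqcode xs))) (srel M s xs)
    & forall s xs,
        fun_arity (slang M) s = Some (size xs) -> all (sdom M) xs ->
        phi emptyset i (cpair 4 (cpair s (seqcode xs))) (sfun M s xs)].

Definition unif_high_isomorphism (d : tdegree) : Prop :=
  exists (D : cantor) (f : nat -> nat),
    [/\ d D, computable f
      & forall i j M N, st_listed i M -> st_listed j N -> isomorphic M N ->
          isomorphism (phi D (f (cpair i j))) M N].

(* Main.v *)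
Require Import Defs.
From mathcomp Require Import all_boot zify.
From Stdlib Require Import ClassicalEpsilon.
From Stdlib Require Cantor List.

Set Implicit Arguments.
Unset Strict Implicit.
Unset Printing Implicit Defensive.

(* The isomorphisms from M_i to M_j are the paths of a tree on omega which is
   computable uniformly in c = <i, j>.  Suppose g(0), ..., g(n-1) bound some path
   of the tree.  Order the nodes of length > n below these bounds by their entry
   at n first and by Kleene-Brouwer second.  This order is ill-founded, and the
   first term of any descending sequence bounds the entry at n of some path that
   still obeys g(0), ..., g(n-1): take it as g(n).  Uniform highness makes g
   computable in D uniformly in c.  The paths below g form a compact
   Pi^0_1(D) class.  To keep uniformity when the tree of c has no path, a PA
   degree over D is used through a single total extension of a partial
   D-computable binary function: asked about a node s and a number k, that
   function tells which dies first, the extension of s by k or all extensions by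
   numbers between k and the bound. *)

(** * Total functionals computable uniformly in the oracle *)

(** One program serves all oracles, and totality frees composition from convergence conditions.
    Partial computations are handled with [eval] directly. *)
Definition cf (f : cantor -> nat -> nat) : Prop :=
  exists p, forall A x, eval A p x (f A x).

Definition cfb (b : cantor -> nat -> bool) : Prop :=
  cf (fun A x => nat_of_bool (b A x)).

Definition cfl (l : cantor -> nat -> seq nat) : Prop :=
  cf (fun A x => seqcode (l A x)).

Lemma cpair_eta x : cpair (cfst x) (csnd x) = x.
Proof. by rewrite /cpair /cfst /csnd -surjective_pairing Cantor.cancel_to_of. Qed.

Lemma cf_ext f g : (forall A x, f A x = g A x) -> cf f -> cf g.
Proof. by move=> E [p Hp]; exists p => A x; rewrite -E. Qed.

Lemma cf_id : cf (fun _ x => x).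
Proof.
exists (Pair Fst Snd) => A x; rewrite -{2}(cpair_eta x).
by apply: ev_pair; constructor.
Qed.

Lemma cf_comp f g : cf f -> cf g -> cf (fun A x => f A (g A x)).
Proof.
by move=> [p Hp] [q Hq]; exists (Comp p q) => A x; apply: ev_comp (Hq A x) _.
Qed.

Lemma cf_succ f : cf f -> cf (fun A x => (f A x).+1).
Proof. by apply: (cf_comp (f := fun _ x => x.+1)); exists Succ; constructor. Qed.

Lemma cf_fst f : cf f -> cf (fun A x => cfst (f A x)).
Proof. by apply: (cf_comp (f := fun _ x => cfst x)); exists Fst; constructor. Qed.

Lemma cf_snd f : cf f -> cf (fun A x => csnd (f A x)).
Proof. by apply: (cf_comp (f := fun _ x => csnd x)); exists Snd; constructor. Qed.

Lemma cf_oracle f : cf f -> cfb (fun A x => A (f A x)).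
Proof.
by apply: (cf_comp (f := fun A x => nat_of_bool (A x))); exists Oracle; constructor.
Qed.

Lemma cf_pair f g : cf f -> cf g -> cf (fun A x => cpair (f A x) (g A x)).
Proof. by move=> [p Hp] [q Hq]; exists (Pair p q) => A x; apply: ev_pair. Qed.

Fixpoint cst (n : nat) : prog := if n is m.+1 then Comp Succ (cst m) else Zero.

Lemma eval_cst A n x : eval A (cst n) x n.
Proof.
by elim: n => [|n IH] /=; [constructor | apply: ev_comp IH _; constructor].
Qed.

Lemma cf_const n : cf (fun _ _ => n).
Proof. by exists (cst n) => A x; apply: eval_cst. Qed.

Lemma cf_rec f h n : cf f ->
  cf (fun A z => h A (cfst z) (cfst (csnd z)) (csnd (csnd z))) -> cf n ->
  cf (fun A x => nat_rec (fun=> nat) (f A x) (fun k r => h A x k r) (n A x)).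
Proof.
move=> [p Hp] [q Hq] [r Hr]; have [i Hi] := cf_id.
exists (Comp (Prec p q) (Pair i r)) => A x.
apply: ev_comp (ev_pair (Hi A x) (Hr A x)) _.
elim: (n A x) => [|m IH] /=; first exact: ev_prec0.
apply: ev_precS IH _.
have := Hq A (cpair x (cpair m (nat_rec (fun=> nat) (f A x) (h A x) m))).
by rewrite !(cfst_pair, csnd_pair).
Qed.

Lemma cf_iter n h z : cf n -> cf (fun A w => h A (cfst w) (csnd w)) -> cf z ->
  cf (fun A x => iter (n A x) (h A x) (z A x)).
Proof.
move=> Hn Hh Hz.
apply: (cf_ext (f := fun A x =>
  nat_rec (fun=> nat) (z A x) (fun _ r => h A x r) (n A x))).
  by move=> A x; elim: (n A x) => //= m ->.
apply: (cf_rec (h := fun A x _ r => h A x r)) => //.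
apply: (cf_ext (f := fun A w => h A (cfst (cpair (cfst w) (csnd (csnd w))))
  (csnd (cpair (cfst w) (csnd (csnd w)))))).
  by move=> A x; rewrite !(cfst_pair, csnd_pair).
apply: (cf_comp (f := fun A w => h A (cfst w) (csnd w))) => //.
by apply: cf_pair; do ?apply: cf_snd; do ?apply: cf_fst; apply: cf_id.
Qed.

Lemma cf_if b f g : cfb b -> cf f -> cf g ->
  cf (fun A x => if b A x then f A x else g A x).
Proof.
move=> Hb Hf Hg.
apply: (cf_ext (f := fun A x =>
  nat_rec (fun=> nat) (g A x) (fun _ _ => f A x) (b A x))).
  by move=> A x; case: (b A x).
apply: (cf_rec (h := fun A x _ _ => f A x)) => //.
exact/(cf_comp Hf)/cf_fst/cf_id.
Qed.

Lemma cf_pred f : cf f -> cf (fun A x => (f A x).-1).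
Proof.
move=> Hf; apply: (cf_ext (f := fun A x =>
  nat_rec (fun=> nat) 0 (fun k _ => k) (f A x))).
  by move=> A x; case: (f A x).
apply: (cf_rec (h := fun _ _ k _ => k)) => //; first exact: cf_const.
exact/cf_fst/cf_snd/cf_id.
Qed.

Lemma cf_add f g : cf f -> cf g -> cf (fun A x => f A x + g A x).
Proof.
move=> Hf Hg; apply: (cf_ext (f := fun A x => iter (f A x) (fun r => r.+1) (g A x))).
  by move=> A x; elim: (f A x) => //= m ->.
by apply: cf_iter => //; apply/cf_succ/cf_snd/cf_id.
Qed.

Lemma cf_sub f g : cf f -> cf g -> cf (fun A x => f A x - g A x).
Proof.
move=> Hf Hg; apply: (cf_ext (f := fun A x => iter (g A x) (fun r => r.-1) (f A x))).
  by move=> A x; elim: (g A x) => [|m /= ->]; rewrite ?subn0 // subnS.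
by apply: cf_iter => //; apply/cf_pred/cf_snd/cf_id.
Qed.

Lemma cfb_eq0 f : cf f -> cfb (fun A x => f A x == 0).
Proof.
move=> Hf; apply: (cf_ext (f := fun A x => 1 - f A x)).
  by move=> A x; case: (f A x).
by apply: cf_sub => //; apply: cf_const.
Qed.

Lemma cfb_leq f g : cf f -> cf g -> cfb (fun A x => f A x <= g A x).
Proof. by move=> Hf Hg; apply/cfb_eq0/cf_sub. Qed.

Lemma cfb_and a b : cfb a -> cfb b -> cfb (fun A x => a A x && b A x).
Proof.
move=> Ha Hb; apply: (cf_ext (f := fun A x => if a A x then nat_of_bool (b A x) else 0)).
  by move=> A x; case: (a A x).
by apply: cf_if => //; apply: cf_const.
Qed.

Lemma cfb_not a : cfb a -> cfb (fun A x => ~~ a A x).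
Proof.
move=> Ha; apply: (cf_ext (f := fun A x => if a A x then 0 else 1)).
  by move=> A x; case: (a A x).
by apply: cf_if => //; apply: cf_const.
Qed.

Lemma cfb_or a b : cfb a -> cfb b -> cfb (fun A x => a A x || b A x).
Proof.
move=> Ha Hb; apply: (cf_ext (f := fun A x => nat_of_bool (~~ (~~ a A x && ~~ b A x)))).
  by move=> A x; case: (a A x); case: (b A x).
by apply/cfb_not/cfb_and; apply: cfb_not.
Qed.

Lemma cfb_imp a b : cfb a -> cfb b -> cfb (fun A x => a A x ==> b A x).
Proof.
move=> Ha Hb; apply: (cf_ext (f := fun A x => nat_of_bool (~~ a A x || b A x))).
  by move=> A x; case: (a A x).
by apply: cfb_or => //; apply: cfb_not.
Qed.

Lemma cfb_eq f g : cf f -> cf g -> cfb (fun A x => f A x == g A x).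
Proof.
move=> Hf Hg; apply: (cf_ext (f := fun A x =>
  nat_of_bool ((f A x <= g A x) && (g A x <= f A x)))).
  by move=> A x; rewrite -eqn_leq.
by apply: cfb_and; apply: cfb_leq.
Qed.

Lemma cfb_all P n : cfb (fun A z => P A (cfst z) (csnd z)) -> cf n ->
  cfb (fun A x => all (fun i => P A x i) (iota 0 (n A x))).
Proof.
move=> HP Hn; apply: (cf_ext (f := fun A x => nat_rec (fun=> nat) 1
  (fun k r => nat_of_bool (P A x k && (r == 1))) (n A x))).
  move=> A x; elim: (n A x) => // m IH.
  by rewrite -[in RHS]addn1 iotaD all_cat /= IH andbT eqb1 andbC.
apply: (cf_rec (h := fun A x k r => nat_of_bool (P A x k && (r == 1)))) => //.
  exact: cf_const.
apply: cfb_and.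
  apply: (cf_ext (f := fun A w => nat_of_bool (P A (cfst (cpair (cfst w) (cfst (csnd w))))
    (csnd (cpair (cfst w) (cfst (csnd w))))))).
    by move=> A x; rewrite !(cfst_pair, csnd_pair).
  apply: (cf_comp HP); apply: cf_pair; do ?apply: cf_snd; do ?apply: cf_fst.
    exact: cf_id.
  exact/cf_snd/cf_id.
by apply: cfb_eq; [do 2!apply: cf_snd; apply: cf_id | apply: cf_const].
Qed.

(** Substituting a program for the oracle turns a reduction between oracles into a translation of
    programs. *)
Fixpoint reoracle (r p : prog) : prog :=
  match p with
  | Oracle => r
  | Pair p q => Pair (reoracle r p) (reoracle r q)
  | Comp p q => Comp (reoracle r p) (reoracle r q)
  | Prec p q => Prec (reoracle r p) (reoracle r q)
  | Mu p => Mu (reoracle r p)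
  | _ => p
  end.

Lemma eval_reoracle (A B : cantor) r p x y :
  (forall z, eval B r z (A z)) -> eval A p x y -> eval B (reoracle r p) x y.
Proof.
move=> Hr; elim=> {p x y} /= [||||||p q x y z _ Hy _ Hz|||p a n w _ Hw _ H0];
  try by constructor.
- by move=> x; apply: Hr.
- exact: ev_comp Hy Hz.
- by move=> p q a n y z _ Hy _ Hz; apply: ev_precS Hy Hz.
- exact: ev_mu Hw H0.
Qed.

(** [Zero] answers every query to the empty oracle, so unrelativized computations can be simulated
    over any oracle. *)
Lemma cf_empty f : cf f -> cf (fun _ x => f emptyset x).
Proof.
move=> [p Hp]; exists (reoracle Zero p) => A x.
by apply: eval_reoracle (Hp emptyset x) => z; constructor.
Qed.

(** A hook for [cfs], redefined once the closure lemmas on sequences are available. *)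
Ltac cfs_user := fail.

Ltac cfs := cbv beta; repeat (cbv beta; first
  [ assumption | exact: cf_id | exact: cf_const
  | lazymatch goal with
    | |- cf (fun A x => cfst (@?f A x)) => apply: (cf_fst (f := f))
    | |- cf (fun A x => csnd (@?f A x)) => apply: (cf_snd (f := f))
    | |- cf (fun A x => (@?f A x).+1) => apply: (cf_succ (f := f))
    | |- cf (fun A x => (@?f A x).-1) => apply: (cf_pred (f := f))
    | |- cf (fun A x => cpair (@?f A x) (@?g A x)) => apply: (cf_pair (f := f) (g := g))
    | |- cf (fun A x => (@?f A x) + (@?g A x)) => apply: (cf_add (f := f) (g := g))
    | |- cf (fun A x => (@?f A x) - (@?g A x)) => apply: (cf_sub (f := f) (g := g))
    | |- cf (fun A x => nat_of_bool (@?b A x)) => change (cfb b)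
    | |- cfb (fun A x => (@?a A x) && (@?b A x)) => apply: (cfb_and (a := a) (b := b))
    | |- cfb (fun A x => (@?a A x) || (@?b A x)) => apply: (cfb_or (a := a) (b := b))
    | |- cfb (fun A x => (@?a A x) ==> (@?b A x)) => apply: (cfb_imp (a := a) (b := b))
    | |- cfb (fun A x => ~~ (@?a A x)) => apply: (cfb_not (a := a))
    | |- cfb (fun A x => (@?f A x) <= (@?g A x)) => apply: (cfb_leq (f := f) (g := g))
    | |- cfb (fun A x => @eq_op Datatypes_nat__canonical__eqtype_Equality (@?f A x) (@?g A x)) =>
        apply: (cfb_eq (f := f) (g := g))
    | |- cfb (fun A x => all (@?P A x) (iota 0 (@?n A x))) =>
        apply: (cfb_all (P := P) (n := n))
    end
  | match goal with
    | H : cf ?f |- cf (fun A x => ?f A (@?g A x)) => apply: (cf_comp (g := g) H)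
    | H : cfb ?b |- cfb (fun A x => ?b A (@?g A x)) => apply: (cf_comp (g := g) H)
    | H : cfl ?l |- cfl (fun A x => ?l A (@?g A x)) => apply: (cf_comp (g := g) H)
    end
  | simple apply cf_if
  | cfs_user ]).

(** * Finite sequences *)

Lemma cpair_spec x y : (cpair x y).*2 = y.*2 + (y + x) * (y + x).+1.
Proof. have := Cantor.to_nat_spec x y; rewrite -/(cpair x y); lia. Qed.

Lemma cpair_ge_snd x y : y <= cpair x y.
Proof. have := cpair_spec x y; lia. Qed.

Lemma cpair_le x y x' y' : x <= x' -> y <= y' -> cpair x y <= cpair x' y'.
Proof. have := cpair_spec x y; have := cpair_spec x' y'; nia. Qed.

(** The fuel [k] makes the recursion structural; [n] is enough fuel, since the code of a tail is
    smaller than that of the whole sequence. *)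
Fixpoint decn (k n : nat) : seq nat :=
  match k, n with
  | k'.+1, m.+1 => cfst m :: decn k' (csnd m)
  | _, _ => [::]
  end.

Definition dec (n : nat) : seq nat := decn n n.

Lemma seqcodeK : cancel seqcode dec.
Proof.
move=> s; rewrite /dec; have := leqnn (seqcode s); move: {2 3}(seqcode s) => k.
elim: s k => [|x s IH] [|k] //=; rewrite cfst_pair csnd_pair ltnS => le.
by rewrite IH // (leq_trans _ le) // cpair_ge_snd.
Qed.

Lemma decK : cancel dec seqcode.
Proof.
move=> n; rewrite /dec; have := leqnn n; move: {2 3}n => k.
elim: k n => [|k IH] [|n] //= le; rewrite IH ?cpair_eta //.
by apply: (leq_trans _ (le : n <= k)); rewrite -{2}(cpair_eta n) cpair_ge_snd.
Qed.

(** The pairing is monotone in both arguments. Hence a search through all sequences of a given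
    length below a bound is a bounded search on codes. *)
Lemma seqcode_le s t : size s = size t ->
  (forall i, i < size s -> nth 0 s i <= nth 0 t i) -> seqcode s <= seqcode t.
Proof.
elim: s t => [|x s IH] [|y t] //= [Es] H; rewrite ltnS.
by apply: cpair_le; [apply: (H 0) | apply: IH => // i; apply: (H i.+1)].
Qed.

Lemma size_seqcode s : size s <= seqcode s.
Proof. by elim: s => //= x s IH; rewrite ltnS (leq_trans IH) ?cpair_ge_snd. Qed.

Lemma cfl_dec f : cf f -> cfl (fun A x => dec (f A x)).
Proof. by apply: cf_ext => A x; rewrite decK. Qed.

Lemma cf_nth l f : cfl l -> cf f -> cf (fun A x => nth 0 (l A x) (f A x)).
Proof.
(* The map [csnd c.-1] takes a code to that of the tail; past the end it stays at 0, in agreement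
   with the default of [nth]. *)
move=> Hl Hf; apply: (cf_ext (f := fun A x =>
  cfst (iter (f A x) (fun c => csnd c.-1) (seqcode (l A x))).-1)).
  move=> A x; elim: (f A x) (l A x) => [|k IH] s.
    by case: s => //= y s; rewrite cfst_pair.
  rewrite iterSr; case: s => [|y s]; first by rewrite -(nth_nil 0 k) -IH.
  by rewrite /= csnd_pair IH.
by apply: cf_fst; apply: cf_pred; apply: cf_iter => //; cfs.
Qed.

Lemma cf_foldl h z l :
  cf (fun A w => h A (cfst w) (cfst (csnd w)) (csnd (csnd w))) -> cf z -> cfl l ->
  cf (fun A x => foldl (h A x) (z A x) (l A x)).
Proof.
move=> Hh Hz Hl.
(* The state pairs the code of the unread part with the accumulator and is stationary once all is
   read. The code is at least the length, so it is a sufficient number of rounds. *)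
pose st A x w := if cfst w == 0 then w else
  cpair (csnd (cfst w).-1) (h A x (csnd w) (cfst (cfst w).-1)).
apply: (cf_ext (f := fun A x => csnd (iter (seqcode (l A x)) (st A x)
   (cpair (seqcode (l A x)) (z A x))))).
  move=> A x; have := size_seqcode (l A x); move: {1 2}(seqcode _) => k.
  elim: (l A x) (z A x) k => [|y s IH] a k.
    move=> _; elim: k => [|k IHk]; first by rewrite csnd_pair.
    by rewrite iterSr /st cfst_pair.
  case: k => // k /IH Hs; rewrite iterSr {2}/st cfst_pair csnd_pair /=.
  by rewrite cfst_pair csnd_pair Hs.
apply: cf_snd; apply: cf_iter => //; last exact: cf_pair.
rewrite /st; cfs.
apply: (cf_ext (f := fun A w => let w' := cpair (cfst w) (cpair (csnd (csnd w))
  (cfst (cfst (csnd w)).-1)) in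
  h A (cfst w') (cfst (csnd w')) (csnd (csnd w')))).
  by move=> A x; rewrite /= !(cfst_pair, csnd_pair).
by apply: (cf_comp Hh); cfs.
Qed.

Lemma cf_size l : cfl l -> cf (fun A x => size (l A x)).
Proof.
move=> Hl; apply: (cf_ext (f := fun A x => foldl (fun a _ => a.+1) 0 (l A x))).
  move=> A x; rewrite -[RHS]addn0; elim: (l A x) 0 => //= y s IH k.
  by rewrite IH addnS.
by apply: cf_foldl => //; cfs.
Qed.

Lemma cfl_catrev l r : cfl l -> cfl r -> cfl (fun A x => catrev (l A x) (r A x)).
Proof.
move=> Hl Hr; apply: (cf_ext (f := fun A x =>
  foldl (fun a y => (cpair y a).+1) (seqcode (r A x)) (l A x))).
  by move=> A x; elim: (l A x) (r A x) => //= y s IH r'; rewrite -IH.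
by apply: cf_foldl => //; cfs.
Qed.

Lemma cfl_rcons l f : cfl l -> cf f -> cfl (fun A x => rcons (l A x) (f A x)).
Proof.
move=> Hl Hf.
apply: (cf_ext (f := fun A x => seqcode (catrev (f A x :: catrev (l A x) [::]) [::]))).
  by move=> A x; rewrite -/(rev _) -/(rev _) rev_cons revK.
apply: cfl_catrev; last exact: cf_const.
rewrite /cfl /=; apply: cf_succ; apply: cf_pair => //.
by apply: cfl_catrev => //; apply: cf_const.
Qed.

Lemma cfl_mkseq f n : cf (fun A w => f A (cfst w) (csnd w)) -> cf n ->
  cfl (fun A x => mkseq (f A x) (n A x)).
Proof.
move=> Hf Hn; apply: (cf_ext (f := fun A x => nat_rec (fun=> nat) 0
  (fun k r => seqcode (rcons (dec r) (f A x k))) (n A x))).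
  by move=> A x; elim: (n A x) => // k IH; rewrite mkseqS /= IH seqcodeK.
apply: (cf_rec (h := fun A x k r => seqcode (rcons (dec r) (f A x k)))); cfs.
apply: cfl_rcons; first by apply: cfl_dec; cfs.
apply: (cf_ext (f := fun A w => let w' := cpair (cfst w) (cfst (csnd w)) in
  f A (cfst w') (csnd w'))).
  by move=> A x; rewrite /= !(cfst_pair, csnd_pair).
by apply: (cf_comp Hf); cfs.
Qed.

(** Unlike [take], this pads a short sequence with 0, so the length is always [n]. *)
Definition pre (s : seq nat) (n : nat) : seq nat := mkseq (nth 0 s) n.

Lemma cfl_pre l n : cfl l -> cf n -> cfl (fun A x => pre (l A x) (n A x)).
Proof.
move=> Hl Hn; apply: (cfl_mkseq (f := fun A x => nth 0 (l A x))) => //.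
apply: (cf_nth (l := fun A w => l A (cfst w))); last by cfs.
by apply: (cf_comp Hl); cfs.
Qed.

Lemma pre_mkseq (P : nat -> nat) m n : n <= m -> pre (mkseq P m) n = mkseq P n.
Proof.
move=> le; apply/eq_in_map => i; rewrite mem_iota /= add0n => lt.
by rewrite nth_mkseq // (leq_trans lt).
Qed.

Lemma pre_pre s m n : n <= m -> pre (pre s m) n = pre s n.
Proof. exact: pre_mkseq. Qed.

Lemma size_pre s n : size (pre s n) = n.
Proof. exact: size_mkseq. Qed.

Lemma nth_pre s n i : i < n -> nth 0 (pre s n) i = nth 0 s i.
Proof. exact: nth_mkseq. Qed.

Ltac cfs_user ::= lazymatch goal with
  | |- cfl (fun A x => dec (@?f A x)) => apply: (cfl_dec (f := f))
  | |- cfl (fun A x => rcons (@?l A x) (@?f A x)) => apply: (cfl_rcons (l := l) (f := f))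
  | |- cfl (fun A x => pre (@?l A x) (@?f A x)) => apply: (cfl_pre (l := l) (n := f))
  | |- cfl (fun A x => mkseq (@?f A x) (@?n A x)) => apply: (cfl_mkseq (f := f) (n := n))
  | |- cf (fun A x => nth 0 (@?l A x) (@?f A x)) => apply: (cf_nth (l := l) (f := f))
  | |- cf (fun A x => size (@?l A x)) => apply: (cf_size (l := l))
  | |- cf (fun A x => seqcode (@?l A x)) => change (cfl l)
  | |- cf (fun A x => iter (@?n A x) (@?h A x) (@?z A x)) =>
      apply: (cf_iter (n := n) (h := h) (z := z))
  end.

Lemma cfb_eqseq l r : cfl l -> cfl r -> cfb (fun A x => l A x == r A x).
Proof.
move=> Hl Hr.
apply: (cf_ext (f := fun A x => nat_of_bool (seqcode (l A x) == seqcode (r A x)))).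
  by move=> A x; rewrite (inj_eq seqcode_inj).
exact: cfb_eq.
Qed.

(* The Kleene-Brouwer order: a proper extension comes before its prefix. *)
Fixpoint kble (s t : seq nat) : bool :=
  match s, t with
  | _, [::] => true
  | [::], _ :: _ => false
  | x :: s', y :: t' => (x < y) || (x == y) && kble s' t'
  end.

Lemma kble_refl s : kble s s.
Proof. by elim: s => //= x s ->; rewrite eqxx orbT. Qed.

Lemma kble_anti s t : kble s t -> kble t s -> s = t.
Proof.
elim: s t => [|x s IH] [|y t] //=.
by case: (ltngtP x y) => //= -> Hs Ht; rewrite (IH t).
Qed.

Lemma kble_trans s t u : kble s t -> kble t u -> kble s u.
Proof.
elim: s t u => [|x s IH] [|y t] [|z u] //=.
case: (ltngtP x y) => //= [xy _|->]; last by case: ltngtP => //= _; apply: IH.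
by case: (ltngtP y z) => //= [yz _|<- _]; rewrite ?xy // (ltn_trans xy yz).
Qed.

Lemma kble_total s t : kble s t || kble t s.
Proof. by elim: s t => [|x s IH] [|y t] //=; case: ltngtP => //= _; apply: IH. Qed.

Lemma kble_prefix s t : prefix t s -> kble s t.
Proof. by elim: s t => [|x s IH] [|y t] //= /andP [/eqP -> /IH ->]; rewrite eqxx orbT. Qed.

Lemma cfb_kble l r : cfl l -> cfl r -> cfb (fun A x => kble (l A x) (r A x)).
Proof.
move=> Hl Hr.
(* the state is [cpair v t]: the verdict is open for v = 0, true for v = 1,
   false for v = 2, and t is the part of the second sequence still to compare *)
pose st (w x : nat) := if cfst w != 0 then w else
  if csnd w == 0 then cpair 1 0 else
  if x < cfst (csnd w).-1 then cpair 1 0 else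
  if x == cfst (csnd w).-1 then cpair 0 (csnd (csnd w).-1) else cpair 2 0.
pose out w := (cfst w == 1) || (cfst w == 0) && (csnd w == 0).
apply: (cf_ext (f := fun A x =>
  nat_of_bool (out (foldl st (cpair 0 (seqcode (r A x))) (l A x))))).
  have stuck v s : v != 0 -> foldl st (cpair v 0) s = cpair v 0.
    by move=> v0; elim: s => //= x s IH; rewrite {2}/st cfst_pair v0.
  move=> A x; congr nat_of_bool; elim: (l A x) (r A x) => [|y s IH] [|z t] /=.
  - by rewrite /out cfst_pair csnd_pair.
  - by rewrite /out cfst_pair csnd_pair.
  - by rewrite {2}/st cfst_pair csnd_pair /= stuck // /out cfst_pair.
  - rewrite {2}/st !(cfst_pair, csnd_pair) /=.
    by case: ltngtP => //= _; rewrite ?IH // stuck // /out cfst_pair.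
suff H : cf (fun A x => foldl st (cpair 0 (seqcode (r A x))) (l A x)).
  by rewrite /out; cfs.
apply: (cf_foldl (h := fun _ _ => st)) => //; last by cfs.
by rewrite /st; cfs.
Qed.

(** * A universal stack machine *)

(* A machine state is either [mev e x K], asking for the value of the program
   coded by e at x, or [mret v K], returning the value v; the stack K is a
   coded list of frames. *)
Definition mev (e x K : nat) : nat := cpair 0 (cpair e (cpair x K)).
Definition mret (v K : nat) : nat := cpair 1 (cpair v (cpair 0 K)).
(** The tag [t] says what to do with the returned value: 0, evaluate the second half of a pair; 1,
    complete the pair; 2, apply the outer program of a composition; 3, apply the step of a
    recursion; 4, test the value in a search. The successor keeps 0 for the empty stack. *)
Definition mpush (t d K : nat) : nat := (cpair (cpair t d) K).+1.

Definition step_ev (A : cantor) (e x K : nat) : nat :=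
  let o := cfst e in
  let p := cfst (csnd e) in
  let q := csnd (csnd e) in
  if o == 0 then mret 0 K else
  if o == 1 then mret x.+1 K else
  if o == 2 then mret (cfst x) K else
  if o == 3 then mret (csnd x) K else
  if o == 4 then mret (A x) K else
  if o == 5 then mev p x (mpush 0 (cpair q x) K) else
  if o == 6 then mev q x (mpush 2 p K) else
  if o == 7 then
    if csnd x == 0 then mev p (cfst x) K else
    mev e (cpair (cfst x) (csnd x).-1)
      (mpush 3 (cpair q (cpair (cfst x) (csnd x).-1)) K)
  else mev (csnd e) (cpair x 0) (mpush 4 (cpair (csnd e) (cpair x 0)) K).

Definition step_ret (v t d K : nat) : nat :=
  if t == 0 then mev (cfst d) (csnd d) (mpush 1 v K) else
  if t == 1 then mret (cpair d v) K else
  if t == 2 then mev d v K else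
  if t == 3 then mev (cfst d) (cpair (cfst (csnd d)) (cpair (csnd (csnd d)) v)) K else
  if v == 0 then mret (csnd (csnd d)) K else
  let x := cpair (cfst (csnd d)) (csnd (csnd d)).+1 in
  mev (cfst d) x (mpush 4 (cpair (cfst d) x) K).

Definition step (A : cantor) (w : nat) : nat :=
  let e := cfst (csnd w) in
  let x := cfst (csnd (csnd w)) in
  let K := csnd (csnd (csnd w)) in
  if cfst w == 0 then step_ev A e x K else
  if K == 0 then w else
  step_ret e (cfst (cfst K.-1)) (csnd (cfst K.-1)) (csnd K.-1).

(** The result is shifted: 0 means that no value has been returned within [t] steps, and [v.+1] that
    the value is [v]. *)
Definition run (A : cantor) (t e x : nat) : nat :=
  let w := iter t (step A) (mev e x 0) in
  if (cfst w == 1) && (csnd (csnd (csnd w)) == 0) then (cfst (csnd w)).+1 else 0.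

Lemma cf_step_ev f g h : cf f -> cf g -> cf h ->
  cf (fun A x => step_ev A (f A x) (g A x) (h A x)).
Proof.
move=> Hf Hg Hh; rewrite /step_ev /mev /mret /mpush; cfs.
exact: cf_oracle.
Qed.

Lemma cf_step_ret f g h k : cf f -> cf g -> cf h -> cf k ->
  cf (fun A x => step_ret (f A x) (g A x) (h A x) (k A x)).
Proof. by move=> Hf Hg Hh Hk; rewrite /step_ret /mev /mret /mpush; cfs. Qed.

Lemma cf_run f g h : cf f -> cf g -> cf h ->
  cf (fun A x => run A (f A x) (g A x) (h A x)).
Proof.
move=> Hf Hg Hh.
have Hi : cf (fun A x => iter (f A x) (step A) (mev (g A x) (h A x) 0)).
  apply: (cf_iter (h := fun A _ => step A)) => //; last by rewrite /mev; cfs.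
  rewrite /step; cfs; first by apply: cf_step_ev; cfs.
  by apply: cf_step_ret; cfs.
by rewrite /run; cfs.
Qed.

Lemma cf_run0 f g h : cf f -> cf g -> cf h ->
  cf (fun A x => run emptyset (f A x) (g A x) (h A x)).
Proof.
move=> Hf Hg Hh; apply: (cf_ext (f := fun A x =>
  let w := cpair (f A x) (cpair (g A x) (h A x)) in
  run emptyset (cfst w) (cfst (csnd w)) (csnd (csnd w)))).
  by move=> A x; rewrite /= !(cfst_pair, csnd_pair).
apply: (cf_comp (f := fun _ w => run emptyset (cfst w) (cfst (csnd w)) (csnd (csnd w)))).
  apply: (cf_empty (f := fun A w => run A (cfst w) (cfst (csnd w)) (csnd (csnd w)))).
  by apply: cf_run; cfs.
by cfs.
Qed.

Lemma step_mev A e x K : step A (mev e x K) = step_ev A e x K.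
Proof. by rewrite /step /mev !(cfst_pair, csnd_pair). Qed.

Lemma step_mret A v t d K : step A (mret v (mpush t d K)) = step_ret v t d K.
Proof. by rewrite /step /mret /mpush !(cfst_pair, csnd_pair). Qed.

Definition reaches (A : cantor) (w w' : nat) : Prop := exists n, iter n (step A) w = w'.

Lemma reaches_refl A w : reaches A w w.
Proof. by exists 0. Qed.

Lemma reaches_step A w w' : reaches A (step A w) w' -> reaches A w w'.
Proof. by case=> n E; exists n.+1; rewrite iterSr. Qed.

Lemma reaches_trans A w w' w'' : reaches A w w' -> reaches A w' w'' -> reaches A w w''.
Proof. by move=> [n En] [m Em]; exists (m + n); rewrite iterD En. Qed.

(** The stack is arbitrary so that the induction hypotheses apply to subcomputations, which run on
    top of pushed frames. *)
Lemma eval_reaches A p x y : eval A p x y ->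
  forall K, reaches A (mev (progcode p) x K) (mret y K).
Proof.
have ev e x' K w :
  reaches A (step_ev A e x' K) w -> reaches A (mev e x' K) w.
  by move=> H; apply: reaches_step; rewrite step_mev.
have rt v t d K w :
  reaches A (step_ret v t d K) w -> reaches A (mret v (mpush t d K)) w.
  by move=> H; apply: reaches_step; rewrite step_mret.
elim=> {p x y} /=.
- move=> x K; apply: ev; rewrite /step_ev cfst_pair; exact: reaches_refl.
- move=> x K; apply: ev; rewrite /step_ev cfst_pair; exact: reaches_refl.
- move=> x K; apply: ev; rewrite /step_ev cfst_pair; exact: reaches_refl.
- move=> x K; apply: ev; rewrite /step_ev cfst_pair; exact: reaches_refl.
- move=> x K; apply: ev; rewrite /step_ev cfst_pair; exact: reaches_refl.
- move=> p q x y z _ Hp _ Hq K.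
  apply: ev; rewrite /step_ev !(cfst_pair, csnd_pair) /=.
  apply: reaches_trans (Hp _) _; apply: (rt); rewrite /step_ret /= !(cfst_pair, csnd_pair).
  by apply: reaches_trans (Hq _) _; apply: (rt); apply: reaches_refl.
- move=> p q x y z _ Hq _ Hp K.
  apply: ev; rewrite /step_ev !(cfst_pair, csnd_pair) /=.
  by apply: reaches_trans (Hq _) _; apply: (rt); apply: Hp.
- move=> p q a y _ Hp K.
  by apply: ev; rewrite /step_ev !(cfst_pair, csnd_pair) /=; apply: Hp.
- move=> p q a n y z _ Hy _ Hz K.
  apply: ev; rewrite /step_ev !(cfst_pair, csnd_pair) /=.
  apply: reaches_trans (Hy _) _; apply: (rt); rewrite /step_ret /= !(cfst_pair, csnd_pair).
  exact: Hz.
- move=> p a n w _ Hw _ H0 K.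
  apply: ev; rewrite /step_ev !(cfst_pair, csnd_pair) /=.
  suff loop k m : m + k = n -> reaches A (mev (progcode p) (cpair a m)
      (mpush 4 (cpair (progcode p) (cpair a m)) K)) (mret n K) by apply: (loop n).
  elim: k m => [|k IH] m Ek.
    have -> : m = n by lia.
    apply: reaches_trans (H0 _) _; apply: (rt).
    rewrite /step_ret /= !(cfst_pair, csnd_pair); exact: reaches_refl.
  have lt : m < n by lia.
  apply: reaches_trans (Hw _ lt _) _; apply: (rt).
  by rewrite /step_ret /= !(cfst_pair, csnd_pair); apply: IH; lia.
Qed.

Lemma run_halts A e x y : phi A e x y -> exists t, run A t e x = y.+1.
Proof.
case=> p <- /eval_reaches/(_ 0) [t E]; exists t.
by rewrite /run E /mret !(cfst_pair, csnd_pair).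
Qed.

(** A state that returns a value on the empty stack is a fixed point of [step]. *)
Lemma run_mono A t t' e x v : t <= t' -> run A t e x = v.+1 -> run A t' e x = v.+1.
Proof.
move=> /subnK <-; rewrite /run addnC; case: ifP => // /andP [/eqP E1 /eqP E2] [Ev].
have Em : exists z, iter t (step A) (mev e x 0) = cpair 1 (cpair v (cpair z 0)).
  exists (cfst (csnd (csnd (iter t (step A) (mev e x 0))))).
  by rewrite -{1}(cpair_eta (iter _ _ _)) E1 -{1}(cpair_eta (csnd _)) Ev
             -{1}(cpair_eta (csnd (csnd _))) E2.
case: Em => z Em; rewrite addnC iterD Em; set w := cpair 1 _.
have -> : iter (t' - t) (step A) w = w.
  by elim: (t' - t) => //= k ->; rewrite /step /w !(cfst_pair, csnd_pair).
by rewrite /w !(cfst_pair, csnd_pair).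
Qed.

Lemma run_det A t t' e x v v' : run A t e x = v.+1 -> run A t' e x = v'.+1 -> v = v'.
Proof.
move=> E E'; have [le|/ltnW le] := leqP t t'.
  by have := run_mono le E; rewrite E' => -[].
by have := run_mono le E'; rewrite E => -[].
Qed.

Lemma run_phi A t e x y v : phi A e x y -> run A t e x = v.+1 -> v = y.
Proof. by move=> /run_halts [t' E'] E; apply: run_det E E'. Qed.

Lemma run_eventually A e x y : phi A e x y ->
  exists t0, forall t, t0 <= t -> run A t e x = y.+1.
Proof. by move=> /run_halts [t0 E]; exists t0 => t le; apply: run_mono E. Qed.

(** * Unbounded search, a universal program and the s-m-n theorem *)

Lemma eval_mu_least A p a (f : nat -> nat) n :
  (forall m, eval A p (cpair a m) (f m)) -> f n = 0 ->
  exists2 m, eval A (Mu p) a m & f m = 0.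
Proof.
move=> Hp /eqP fn; have ex : exists n, f n == 0 by exists n.
case: (ex_minnP ex) => m /eqP fm min; exists m => //.
(* [ev_mu] wants the values before the first zero as successors, so their predecessors are
   supplied. *)
apply: (ev_mu (w := fun k => (f k).-1)) => [k lt|]; last by rewrite -fm.
have : f k != 0 by apply: contraTN lt => /min; rewrite -leqNgt.
by case: (f k) (Hp k).
Qed.

(** [Mu] searches for a halting time of the stack machine; one more run up to that time reads off
    the value. *)
Lemma universal : exists U, forall A e x y, phi A e x y -> eval A U (cpair e x) y.
Proof.
have [t Ht] : cf (fun A w => 1 - run A (csnd w) (cfst (cfst w)) (csnd (cfst w))).
  by cfs; apply: cf_run; cfs.
have [o Ho] : cf (fun A w => (run A (csnd w) (cfst (cfst w)) (csnd (cfst w))).-1).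
  by cfs; apply: cf_run; cfs.
have [i Hi] := cf_id.
exists (Comp o (Pair i (Mu t))) => A e x y Hy; have [n En] := run_halts Hy.
case: (eval_mu_least (A := A) (p := t) (a := cpair e x) (n := n)
  (f := fun n => 1 - run A n e x)) => [m||m Hm E].
- by have := Ht A (cpair (cpair e x) m); rewrite !(cfst_pair, csnd_pair).
- by rewrite En.
apply: ev_comp (ev_pair (Hi _ _) Hm) _.
have := Ho A (cpair (cpair e x) m); rewrite !(cfst_pair, csnd_pair).
by case Er: (run A m e x) E => [|v] // _; rewrite (run_phi Hy Er).
Qed.

Definition smn (p : prog) (a : nat) : nat :=
  progcode (Comp p (Pair (cst a) (Pair Fst Snd))).

Lemma eval_smn A p a x y : eval A p (cpair a x) y <-> phi A (smn p a) x y.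
Proof.
have Ha : eval A (Pair (cst a) (Pair Fst Snd)) x (cpair a x).
  apply: ev_pair; first exact: eval_cst.
  by rewrite -{2}(cpair_eta x); apply: ev_pair; constructor.
split=> [H|[q /progcode_inj -> H]].
  by exists (Comp p (Pair (cst a) (Pair Fst Snd))) => //; apply: ev_comp Ha H.
by inversion H; subst; rewrite -(eval_det H2 Ha).
Qed.

(** The code of [cst a] comes from that of [Zero] by iterating a computable map [a] times. *)
Lemma cf_smn p f : cf f -> cf (fun A x => smn p (f A x)).
Proof.
move=> Hf; pose K := progcode (Pair Fst Snd).
apply: (cf_ext (f := fun A x => cpair 6 (cpair (progcode p) (cpair 5 (cpair
  (iter (f A x) (fun c => cpair 6 (cpair (progcode Succ) c)) (progcode Zero)) K))))).
  move=> A x; rewrite /smn [progcode]lock /= -lock /=.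
  by congr (cpair _ (cpair _ (cpair _ (cpair _ _)))); elim: (f A x) => //= n ->.
by cfs.
Qed.

(** * Descending sequences in the Kleene-Brouwer order *)

Lemma kble_nth s t m : (forall i, i < m -> nth 0 s i = nth 0 t i) ->
  m < size s -> m < size t -> kble s t -> nth 0 s m <= nth 0 t m.
Proof.
elim: m s t => [|m IH] [|x s] [|y t] //= H ms mt.
  by case: ltngtP.
have /= -> := H 0 isT; rewrite ltnn eqxx /=; apply: IH => // i; exact: (H i.+1).
Qed.

Lemma kble_eq_prefix s t : (forall i, i < size s -> nth 0 s i = nth 0 t i) ->
  size s <= size t -> kble s t -> s = t.
Proof.
elim: s t => [|x s IH] [|y t] //= H le.
have /= -> := H 0 isT; rewrite ltnn eqxx /= => /IH -> // i; exact: (H i.+1).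
Qed.

Lemma nonincreasing_eventually_const (v : nat -> nat) i0 :
  (forall i, i0 <= i -> v i.+1 <= v i) ->
  exists2 i1, i0 <= i1 & forall i, i1 <= i -> v i = v i1.
Proof.
have mono j : (forall i, j <= i -> v i.+1 <= v i) -> forall i, j <= i -> v i <= v j.
  move=> H; elim=> [|i IH]; rewrite leq_eqVlt => /orP [/eqP <- //|lt //].
  exact: leq_trans (H i lt) (IH lt).
have := leqnn (v i0); move: {2}(v i0) => n; elim: n i0 => [|n IH] i0 le dec_v.
  by exists i0 => // i /(mono _ dec_v); lia.
case: (classic (exists2 i, i0 <= i & v i < v i0)) => [[i i0i lt]|nex].
  case: (IH i) => [|j ij|i1 ii1 H]; first by lia.
    by apply: dec_v; lia.
  by exists i1 => //; lia.
exists i0 => // i i0i; apply/eqP; rewrite eqn_leq (mono _ dec_v) //= leqNgt.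
by apply/negP => lt; apply: nex; exists i.
Qed.

(** Entries settle one position after another. Once the first m entries are constant, the terms have
    length above m and their entries at m are nonincreasing, hence eventually constant. *)
Lemma kb_descending_limit (h : nat -> seq nat) :
  (forall i, kble (h i.+1) (h i) /\ h i.+1 <> h i) ->
  exists P : nat -> nat, forall m, exists i0, forall i, i0 <= i ->
    m <= size (h i) /\ forall j, j < m -> nth 0 (h i) j = P j.
Proof.
move=> desc.
suff lim m : exists v i1, forall i, i1 <= i -> m < size (h i) /\ nth 0 (h i) m = v.
  have [P HP] := choice _ lim; exists P; elim=> [|m [i0 IH]]; first by exists 0.
  have [i1 H1] := HP m; exists (maxn i0 i1) => i; rewrite geq_max => /andP [/IH [le H] /H1 [lt E]].
  by split=> // j; rewrite ltnS leq_eqVlt => /orP [/eqP ->|/H].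
have [n] := ubnP m; elim: n m => // n IHn m; rewrite ltnS => mn.
have [i0 H0] : exists i0, forall i, i0 <= i ->
    m <= size (h i) /\ forall j, j < m -> nth 0 (h i) j = nth 0 (h i0) j.
  suff [i0 [w H]] : exists i0 w, forall i, i0 <= i ->
      m <= size (h i) /\ forall j, j < m -> nth 0 (h i) j = w j.
    exists i0 => i /H [le E]; split=> // j jm; rewrite E //.
    by case: (H i0 (leqnn _)) => _ ->.
  (* The finitely many positions below m are settled from the maximum of their individual stages
     on. *)
  have {IHn} : forall j, j < m -> exists v i1, forall i, i1 <= i ->
      j < size (h i) /\ nth 0 (h i) j = v.
    by move=> j jm; apply: IHn; apply: leq_trans mn.
  elim: m {mn} => [|m IHm] IH; first by exists 0, (fun=> 0).
  case: IHm => [j jm|i0 [w Hw]]; first by apply: IH; lia.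
  have [v [i1 Hv]] := IH m (leqnn _).
  exists (maxn i0 i1), (fun j => if j == m then v else w j) => i.
  rewrite geq_max => /andP [/Hw [le H] /Hv [lt E]]; split=> // j.
  by rewrite ltnS leq_eqVlt; case: eqP => [-> //|_ /H].
have agree i i' : i0 <= i -> i0 <= i' -> forall j, j < m -> nth 0 (h i) j = nth 0 (h i') j.
  by move=> /H0 [_ H] /H0 [_ H'] j jm; rewrite H ?H'.
(* A term of length exactly m would be a prefix of its predecessor, but a proper prefix comes later
   in the order, not earlier. *)
have big i : i0 < i -> m < size (h i).
  case: i => // i le; rewrite ltn_neqAle (H0 _ (leqW le)).1 andbT; apply/eqP => E.
  case: (desc i) => kb []; apply: kble_eq_prefix kb; rewrite -E.
    by apply: agree => //; apply: leqW.
  by case: (H0 i le).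
case: (@nonincreasing_eventually_const (fun i => nth 0 (h i) m) i0.+1) => [i lt|i1 i01 Hc].
  apply: kble_nth; try apply: big; try apply: agree; try lia.
  by case: (desc i).
by exists (nth 0 (h i1) m), i1 => i le; split; [apply: big; lia | apply: Hc].
Qed.

(** * Uniform bounds on paths *)

Section Bound.

Variable R : nat -> seq nat -> bool.
Hypothesis cfbR : forall f l, cf f -> cfl l -> cfb (fun A x => R (f A x) (l A x)).

Definition path_in (c : nat) (P : nat -> nat) : Prop := forall m, R c (mkseq P m).

(** [R c] may fail to be closed under initial segments; asking for all of them yields a tree with
    the same paths. *)
Definition good (c : nat) (s : seq nat) : bool :=
  all (fun m => R c (pre s m)) (iota 0 (size s).+1).

Lemma goodP c s : reflect (forall m, m <= size s -> R c (pre s m)) (good c s).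
Proof.
apply: (iffP allP) => H m; last by rewrite mem_iota add0n ltnS => /H.
by move=> le; apply: H; rewrite mem_iota add0n ltnS.
Qed.

Lemma good_pre c s n : good c s -> n <= size s -> good c (pre s n).
Proof.
move=> /goodP H le; apply/goodP => m; rewrite size_pre => mn.
by rewrite pre_pre // H // (leq_trans mn).
Qed.

Lemma good_path c P n : path_in c P -> good c (mkseq P n).
Proof. by move=> HP; apply/goodP => m; rewrite size_mkseq => le; rewrite pre_mkseq. Qed.

Lemma cfb_good f l : cf f -> cfl l -> cfb (fun A x => good (f A x) (l A x)).
Proof.
by move=> Hf Hl; rewrite /good; cfs; apply: cfbR; cfs.
Qed.

Definition bounded (g s : seq nat) : bool :=
  all (fun i => nth 0 s i <= nth 0 g i) (iota 0 (size g)).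

Lemma boundedP g s : reflect (forall i, i < size g -> nth 0 s i <= nth 0 g i) (bounded g s).
Proof.
apply: (iffP allP) => H i; last by rewrite mem_iota add0n => /H.
by move=> lt; apply: H; rewrite mem_iota.
Qed.

Lemma cfb_bounded l r : cfl l -> cfl r -> cfb (fun A x => bounded (l A x) (r A x)).
Proof.
by move=> Hl Hr; rewrite /bounded; cfs.
Qed.

Definition bdom (c : nat) (g s : seq nat) : bool :=
  [&& size g < size s, bounded g s & good c s].

(* Comparing the entry at [size g] first makes the first term of any descending
   sequence bound that entry of some path. *)
Definition ble (c : nat) (g s t : seq nat) : bool :=
  [&& bdom c g s, bdom c g t
    & (nth 0 s (size g) < nth 0 t (size g)) ||
      (nth 0 s (size g) == nth 0 t (size g)) && kble s t].

Definition bound_order (c : nat) (g : seq nat) : linorder.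
Proof.
refine (@LinOrder (fun x => bdom c g (dec x)) (fun x y => ble c g (dec x) (dec y))
          _ _ _ _ _).
- by move=> x y /and3P [].
- by move=> x Hx; rewrite /ble Hx kble_refl eqxx orbT.
- move=> x y /and3P [_ _ Hxy] /and3P [_ _ Hyx]; apply: (can_inj decK); move: Hxy Hyx.
  by case: ltngtP => //= _; apply: kble_anti.
- move=> x y z /and3P [Hx _ Hxy] /and3P [_ Hz Hyz]; rewrite /ble Hx Hz /=.
  move: Hxy Hyz; case: ltngtP => //= [lt _|-> Hxy].
    by case: ltngtP => //= [lt' _|<- _]; rewrite ?lt // (ltn_trans lt lt').
  by case: ltngtP => //= _; apply: kble_trans.
- move=> x y Hx Hy; rewrite /ble Hx Hy /=; case: ltngtP => /= _; [by left|by right|].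
  by case/orP: (kble_total (dec x) (dec y)); [left|right].
Defined.

(** Longer and longer initial segments of [P] share the entry at [size g] and descend in the
    Kleene-Brouwer order. *)
Lemma bound_order_ill_founded c g P : path_in c P ->
  (forall i, i < size g -> P i <= nth 0 g i) -> ill_founded (bound_order c g).
Proof.
move=> HP le; have dom k : bdom c g (mkseq P (size g + k.+1)).
  rewrite /bdom size_mkseq good_path // andbT; apply/andP; split; first by lia.
  by apply/boundedP => i lt; rewrite nth_mkseq ?le //; lia.
exists (fun k => seqcode (mkseq P (size g + k.+1))); split=> k; rewrite /= ?seqcodeK //.
split=> /=; last by move/seqcode_inj/(congr1 size); rewrite !size_mkseq; lia.
rewrite !seqcodeK /ble !dom /= !nth_mkseq; try lia.
rewrite eqxx kble_prefix ?orbT // prefixE size_mkseq /mkseq -map_take take_iota.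
by rewrite (minn_idPl _) //; lia.
Qed.

(** The entries at [size g] are nonincreasing along [h], so from some stage on they are constant and
    the sequence descends in the Kleene-Brouwer order. Its limit is the path, and its entry there is
    at most the first one. *)
Lemma bound_order_path c g h : descending_seq (bound_order c g) h ->
  exists P, [/\ path_in c P, forall i, i < size g -> P i <= nth 0 g i
    & P (size g) <= nth 0 (dec (h 0)) (size g)].
Proof.
case=> /= dom desc; pose n := size g; pose s i := dec (h i).
have dec_n i : nth 0 (s i.+1) n <= nth 0 (s i) n.
  by case: (desc i) => /and3P [_ _ /=]; rewrite -/n; case: ltngtP.
have [i1 _ Hc] := nonincreasing_eventually_const (i0 := 0) (fun i _ => dec_n i).
have [P HP] : exists P : nat -> nat, forall m, exists i0, forall i, i0 <= i ->
    m <= size (s (i + i1)) /\ forall j, j < m -> nth 0 (s (i + i1)) j = P j.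
  apply: kb_descending_limit => i; case: (desc (i + i1)) => /and3P [_ _ /=] H ne.
  split; last by move/(can_inj decK).
  move: H; rewrite -/n -!/(s _) -(addSn i i1) (Hc (i.+1 + i1)) ?(Hc (i + i1)); lia.
exists P; split.
- move=> m; have [i0 /(_ i0 (leqnn _)) [le H]] := HP m.
  have -> : mkseq P m = pre (s (i0 + i1)) m.
    by apply/eq_in_map => j; rewrite mem_iota /= add0n => /H.
  by case/and3P: (dom (i0 + i1)) => _ _ /goodP; apply.
- move=> i lt; have [i0 /(_ i0 (leqnn _)) [_ <- //]] := HP i.+1.
  by case/and3P: (dom (i0 + i1)) => _ /boundedP H _; apply: H.
- have [i0 /(_ i0 (leqnn _)) [_ <- //]] := HP n.+1.
  by elim: (i0 + i1) => // i IH; apply: leq_trans (dec_n i) IH.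
Qed.


(** Course-of-values recursion with a partial program [q]: the invariant ensures that [q] converges
    on every segment built so far. The program [p] depends on neither the oracle, the parameter [c]
    nor the invariant. *)
Lemma eval_build_sequence q : exists p, forall A c (Inv : seq nat -> Prop),
  Inv [::] ->
  (forall s, Inv s -> exists2 k, eval A q (cpair c (seqcode s)) k & Inv (rcons s k)) ->
  exists P : nat -> nat, forall n,
    Inv (mkseq P n) /\ eval A p (cpair c n) (seqcode (mkseq P n)).
Proof.
have [r Hr] : cf (fun _ w => seqcode (rcons (dec (cfst w)) (csnd w))) by cfs.
exists (Prec Zero (Comp r (Pair (Comp Snd Snd) (Comp q (Pair Fst (Comp Snd Snd)))))).
move=> A c Inv Inv0 InvS.
pose Q s k := eval A q (cpair c (seqcode s)) k /\ Inv (rcons s k).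
pose nxt s := epsilon (inhabits 0) (Q s).
have nxtP s : Inv s -> Q s (nxt s).
  by move=> /InvS [k Hk Ik]; apply: (epsilon_spec _ (Q s)); exists k.
pose S := fix S n := if n is m.+1 then rcons (S m) (nxt (S m)) else [::].
exists (fun n => nxt (S n)) => n.
have -> : mkseq (fun n => nxt (S n)) n = S n by elim: n => // n IH; rewrite mkseqS IH.
elim: n => [|n [/nxtP [Hk Ik] En]]; first by split=> //=; apply: ev_prec0; constructor.
split=> //; apply: ev_precS En _.
apply: (ev_comp (y := cpair (seqcode (S n)) (nxt (S n)))); last first.
  by have := Hr A (cpair (seqcode (S n)) (nxt (S n))); rewrite cfst_pair csnd_pair seqcodeK.
have Hss z : eval A (Comp Snd Snd) (cpair c (cpair n z)) z.
  apply: ev_comp; first exact: ev_snd.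
  rewrite csnd_pair -{2}(csnd_pair n z); exact: ev_snd.
apply: ev_pair; first exact: Hss.
apply: ev_comp Hk; apply: ev_pair; last exact: Hss.
by rewrite -{2}(cfst_pair c (cpair n (seqcode (S n)))); apply: ev_fst.
Qed.

Lemma cfb_ble f l r t : cf f -> cfl l -> cfl r -> cfl t ->
  cfb (fun A x => ble (f A x) (l A x) (r A x) (t A x)).
Proof.
move=> Hf Hl Hr Ht; rewrite /ble /bdom; cfs; try apply: cfb_bounded => //;
  try apply: cfb_good => //; exact: cfb_kble.
Qed.

Lemma eval_path_bound (D : cantor) (f : nat -> nat) : computable f ->
  (forall e L, lo_listed e L -> ill_founded L ->
     exists2 g, descending_seq L g & forall n, phi D (f e) n (g n)) ->
  exists p, forall c, (exists P, path_in c P) ->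
    exists g : nat -> nat, forall n, eval D p (cpair c n) (seqcode (mkseq g n)) /\
      exists2 P, path_in c P & forall i, i < n -> P i <= g i.
Proof.
(* Codes determine programs, so a single program computes [f] at all arguments; with [Zero] for its
   oracle calls it runs over [D]. *)
case=> ef Hef Hf; have [pf Epf Hpf] : exists2 pf, progcode pf = ef &
    forall x, eval D (reoracle Zero pf) x (f x).
  have [pf Epf _] := Hef 0; exists pf => // x; have [pf'] := Hef x.
  rewrite -Epf => /progcode_inj -> H; apply: eval_reoracle H => z; exact: ev_zero.
have [o Ho] : cfb (fun _ w => ble (cfst (cfst w)) (dec (csnd (cfst w)))
    (dec (cfst (csnd w))) (dec (csnd (csnd w)))) by apply: cfb_ble; cfs.
have [sm Hsm] : cf (fun _ w => smn o w) by apply: cf_smn; cfs.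
have [U HU] := universal; have [i Hi] := cf_id.
have [out Hout] : cf (fun _ w => nth 0 (dec (csnd w)) (size (dec (csnd (cfst w))))) by cfs.
(* On [<c, s>]: find an index of the order by s-m-n, apply [f], compute the first term of the
   descending sequence, and return its entry at position [size s]. *)
pose q := Comp out (Pair i (Comp U (Pair (Comp (reoracle Zero pf) sm) Zero))).
have [p Hp] := eval_build_sequence q; exists p => c [P0 HP0].
pose Inv s := exists2 P, path_in c P & forall i, i < size s -> P i <= nth 0 s i.
have [||g Hg] := Hp D c Inv; first by exists P0.
  move=> s [P HP leP].
  have listed : lo_listed (smn o (cpair c (seqcode s))) (bound_order c s).
    move=> x y; apply/eval_smn.
    have := Ho emptyset (cpair (cpair c (seqcode s)) (cpair x y)).
    by rewrite !(cfst_pair, csnd_pair) seqcodeK.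
  have [h desc Hh] := Hf _ _ listed (bound_order_ill_founded HP leP).
  have [Q [HQ leQ leQs]] := bound_order_path desc.
  exists (nth 0 (dec (h 0)) (size s)).
    apply: (ev_comp (y := cpair (cpair c (seqcode s)) (h 0))).
      apply: ev_pair (Hi _ _) _; apply: ev_comp (HU _ _ _ _ (Hh 0)).
      by apply: ev_pair (ev_zero _ _); apply: ev_comp (Hsm _ _) (Hpf _).
    have := Hout D (cpair (cpair c (seqcode s)) (h 0)).
    by rewrite !(cfst_pair, csnd_pair) seqcodeK.
  exists Q => // j; rewrite size_rcons nth_rcons ltnS leq_eqVlt.
  by case: ltngtP => [/leQ|//|->].
exists g => n; have [[P HP leP] En] := Hg n; split=> //; exists P => // j jn.
by have := leP j; rewrite size_mkseq nth_mkseq //; apply.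
Qed.

(** * Paths below a bound *)

Definition level (c : nat) (g w : seq nat) : bool :=
  [&& size w == size g, bounded g w & good c w].

Definition dead (c : nat) (g s : seq nat) (b : nat -> bool) : bool :=
  all (fun w => ~~ [&& level c g (dec w), pre (dec w) (size s) == s
                     & b (nth 0 (dec w) (size s))]) (iota 0 (seqcode g).+1).

(** The bounded search misses nothing: sequences of the length of [g] and below [g] have codes at
    most [seqcode g]. *)
Lemma deadP c g s b : reflect
  (forall w, level c g w -> pre w (size s) = s -> ~~ b (nth 0 w (size s)))
  (dead c g s b).
Proof.
apply: (iffP allP) => H w.
  move=> Hw Es; have := H (seqcode w); rewrite seqcodeK Hw Es eqxx !andTb; apply.
  case/and3P: Hw => /eqP Esz /boundedP le _.
  by rewrite mem_iota ltnS; apply: seqcode_le => // i; rewrite Esz; apply: le.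
by move=> _; apply/negP => /and3P [Hw /eqP Es]; apply/negP/H.
Qed.

Lemma cfb_dead f l r b : cf f -> cfl l -> cfl r ->
  cfb (fun A w => b A (cfst w) (csnd w)) ->
  cfb (fun A x => dead (f A x) (l A x) (r A x) (b A x)).
Proof.
move=> Hf Hl Hr Hb; rewrite /dead /level; cfs.
- by apply: cfb_bounded; cfs.
- by apply: cfb_good; cfs.
- by apply: cfb_eqseq; cfs.
apply: (cf_ext (f := fun A w => let w' := cpair (cfst w)
  (nth 0 (dec (csnd w)) (size (r A (cfst w)))) in
  nat_of_bool (b A (cfst w') (csnd w')))).
  by move=> A x; rewrite /= cfst_pair csnd_pair.
by apply: (cf_comp Hb); cfs.
Qed.

(** At the height [size g], 0 says that all entries above [k] have died, so [k] may be taken; 1 that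
    [k] has died and must be skipped; 2 that nothing is decided yet. A tie gives 0. *)
Definition verdict (c : nat) (g s : seq nat) (k : nat) : nat :=
  if dead c g s (fun v => k < v) then 0 else if dead c g s (fun v => v == k) then 1 else 2.

(** The predecessor of the verdict vanishes exactly when a decision has been made, so [Mu] finds the
    first deciding height. Heights exceed [size s], so that the entry in question exists. *)
Lemma eval_verdict D G : exists psi, forall c (g : nat -> nat) s k,
  (forall n, eval D G (cpair c n) (seqcode (mkseq g n))) ->
  let v t := verdict c (mkseq g (size s + t.+1)) s k in
  (exists t, v t <= 1) ->
  exists2 t, eval D psi (cpair c (cpair (seqcode s) k)) (v t) & v t <= 1.
Proof.
have [a Ha] : cf (fun _ w => cpair (cfst (cfst w))
  (size (dec (cfst (csnd (cfst w)))) + (csnd w).+1)) by cfs.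
have [V HV] : cf (fun _ w => verdict (cfst (cfst w)) (dec (csnd w))
    (dec (cfst (csnd (cfst w)))) (csnd (csnd (cfst w)))).
  by rewrite /verdict; cfs; apply: cfb_dead; cfs.
have [i Hi] := cf_id; have [pr Hpr] : cf (fun _ x => x.-1) by cfs.
pose VG := Comp V (Pair Fst (Comp G a)).
exists (Comp VG (Pair i (Mu (Comp pr VG)))) => c g s k HG v [n vn].
pose z := cpair c (cpair (seqcode s) k).
have HVG t : eval D VG (cpair z t) (v t).
  apply: (ev_comp (y := cpair z (seqcode (mkseq g (size s + t.+1))))).
    apply: ev_pair; first by rewrite -{2}(cfst_pair z t); apply: ev_fst.
    apply: ev_comp (HG _); have := Ha D (cpair z t).
    by rewrite /z !(cfst_pair, csnd_pair) seqcodeK.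
  have := HV D (cpair z (seqcode (mkseq g (size s + t.+1)))).
  by rewrite /z !(cfst_pair, csnd_pair) !seqcodeK.
have [t|/=|t Ht vt] := eval_mu_least (A := D) (p := Comp pr VG) (a := z) (n := n)
  (f := fun t => (v t).-1); first exact: ev_comp (HVG t) (Hpr _ _).
  by lia.
by exists t; [apply: ev_comp (HVG t); apply: ev_pair | lia].
Qed.

(** By compactness this means that some path below [g] extends [s] with its next entry in [b]; the
    formulation by finite levels matches what the search sees. *)
Definition alive (c : nat) (g : nat -> nat) (s : seq nat) (b : nat -> bool) : Prop :=
  forall t, ~~ dead c (mkseq g (size s + t.+1)) s b.

Lemma aliveP c g s b t : alive c g s b ->
  exists w, [/\ level c (mkseq g (size s + t.+1)) w, pre w (size s) = s
              & b (nth 0 w (size s))].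
Proof.
move=> /(_ t) /negP ndead; apply: NNPP => nex; apply: ndead; apply/deadP => w Hw Es.
by apply/negP => bw; apply: nex; exists w.
Qed.

(** A surviving node at the greater height restricts to one at the smaller height. *)
Lemma dead_mono c (g : nat -> nat) s b t t' : t <= t' ->
  dead c (mkseq g (size s + t.+1)) s b -> dead c (mkseq g (size s + t'.+1)) s b.
Proof.
move=> le /deadP H; apply/deadP => w /and3P [/eqP]; rewrite size_mkseq => Esz.
move=> /boundedP; rewrite size_mkseq => bd gd Es.
rewrite -(@nth_pre w (size s + t.+1)); last by lia.
apply: H; last by rewrite pre_pre //; lia.
apply/and3P; split; first by rewrite size_pre size_mkseq.
  apply/boundedP => i; rewrite size_mkseq => lt; rewrite nth_pre // nth_mkseq //.
  by have := bd i; rewrite nth_mkseq; [apply; lia | lia].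
by apply: good_pre => //; lia.
Qed.

(** If both sides died, they would both be dead at the larger of the two heights, where some entry
    of at least [k] survives. *)
Lemma alive_split c g s k : alive c g s (fun v => k <= v) ->
  ~ alive c g s (fun v => v == k) -> alive c g s (fun v => k < v).
Proof.
move=> Ha /not_all_ex_not [t1 /negP/negPn D1] t2; apply/negP => D2.
have /(aliveP (maxn t1 t2)) [w [Hw Es]] := Ha.
have /deadP/(_ w Hw Es) := dead_mono (leq_maxl t1 t2) D1.
have /deadP/(_ w Hw Es) /= := dead_mono (leq_maxr t1 t2) D2.
by case: ltngtP.
Qed.

Lemma alive_bound c g s k : alive c g s (fun v => k <= v) -> k <= g (size s).
Proof.
move=> /(aliveP 0) [w [/and3P [_ /boundedP H _] _ le]]; apply: leq_trans le _.
by have := H (size s); rewrite size_mkseq nth_mkseq; [apply; lia | lia].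
Qed.

Lemma alive_rcons c g s k : alive c g s (fun v => v == k) -> alive c g (rcons s k) predT.
Proof.
move=> Ha t; apply/negP => /deadP; rewrite size_rcons addSnnS => H.
have [w [Hw Es /eqP Ek]] := aliveP t.+1 Ha.
by have := H w Hw; rewrite /pre mkseqS -/(pre _ _) Es Ek => /(_ erefl).
Qed.

Lemma alive_R c g s b : alive c g s b -> R c s.
Proof.
move=> /(aliveP 0) [w [/and3P [/eqP Esz _ /goodP H] <- _]]; apply: H.
by rewrite Esz size_mkseq; lia.
Qed.

(* Whatever [X] answers where no side is dead, the least k it accepts is right. *)
Lemma alive_next c g s (X : nat -> bool) :
  (forall k, (exists t, verdict c (mkseq g (size s + t.+1)) s k <= 1) ->
     exists t, verdict c (mkseq g (size s + t.+1)) s k = X k :> nat) ->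
  alive c g s predT ->
  exists2 k, alive c g s (fun v => v == k) & X k = false /\ forall j, j < k -> X j.
Proof.
move=> HX Ha.
(* If [k] died, the entries above it would stay alive, so the only possible decision would be 1,
   against [X k]. The claim [skip] is dual. *)
have take k : X k = false -> alive c g s (fun v => k <= v) -> alive c g s (fun v => v == k).
  move=> Xk Hk; apply: NNPP => nk; have := alive_split Hk nk => Hgt.
  case: (HX k); last first.
    by move=> t; rewrite Xk /verdict (negbTE (Hgt t)); case: ifP.
  case/not_all_ex_not: nk => t /negP/negPn Dt; exists t.
  by rewrite /verdict Dt; case: ifP.
have skip k : X k -> alive c g s (fun v => k <= v) -> alive c g s (fun v => k < v).
  move=> Xk Hk t; apply/negP => Dt; suff nk : ~ alive c g s (fun v => v == k).
    by have := alive_split Hk nk t; rewrite Dt.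
  move=> Hk1; case: (HX k); first by exists t; rewrite /verdict Dt.
  by move=> t'; rewrite Xk /verdict (negbTE (Hk1 t')); case: ifP.
(* The scan over [k] terminates because a living entry is at most [g (size s)]. *)
suff step_k n k : g (size s) + 1 - k = n -> alive c g s (fun v => k <= v) ->
    (forall j, j < k -> X j) ->
    exists2 k, alive c g s (fun v => v == k) & X k = false /\ forall j, j < k -> X j.
  exact: (step_k _ 0 erefl).
elim: n k => [|n IH] k En Hk Xj; first by have := alive_bound Hk; lia.
case Xk: (X k); last by exists k; [apply: take|].
apply: (IH k.+1); first by lia.
  exact: skip.
by move=> j; rewrite ltnS leq_eqVlt => /orP [/eqP ->|/Xj].
Qed.

End Bound.

(** * Total extensions from PA degrees and the uniform choice of paths *)

(** The total extensions form a class of paths: a string is kept as long as it agrees with every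
    value of [psi] found within as many steps as its length. *)
Lemma PA_total_extension (b d : tdegree) (D : cantor) psi : d D -> PA_over b d ->
  exists X B, [/\ b B, turing_le X B & forall z v, eval D psi z v -> X z = (v != 0)].
Proof.
move=> dD PA; pose e := progcode psi.
(* As [run] is shifted by one, [0 < run] says that the program has halted and [1 < run] that its
   value is nonzero. *)
pose TT (A : cantor) l := all (fun z => (0 < run A (size l) e z) ==>
  (nth 0 l z == (1 < run A (size l) e z))) (iota 0 (size l)).
have TTP (s : seq bool) : reflect (forall z v, z < size s -> run D (size s) e z = v.+1 ->
    nth false s z = (v != 0)) (TT D (map nat_of_bool s)).
  apply: (iffP allP) => H z; last first.
    rewrite mem_iota size_map => lt; apply/implyP.
    case E: (run _ _ _ _) => [|v] // _.
    by rewrite (nth_map false) // (H _ _ lt E) ltnS lt0n.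
  move=> v lt E; have := H z; rewrite mem_iota size_map E => /(_ lt).
  by rewrite (nth_map false) //= ltnS lt0n => /eqP; case: (nth _ _ _); case: (v != 0).
pose cls (X : cantor) := forall z t v, run D t e z = v.+1 -> X z = (v != 0).
have [||X HX [B bB XB]] := PA D cls dD.
- exists (fun s => TT D (map nat_of_bool s)); split.
  + move=> s s' /prefixP [r ->] /TTP H; apply/TTP => z v lt E.
    have := H z v; rewrite nth_cat lt size_cat; apply; first by lia.
    by apply: run_mono E; lia.
  + have [p Hp] : cfb (fun A x => TT A (dec x)).
      by rewrite /TT; cfs; apply: cf_run; cfs.
    exists (progcode p) => s; exists p => //.
    by have := Hp D (strcode s); rewrite /strcode seqcodeK.
  + move=> X; split=> [HX n|HX z t v E].
      apply/TTP => z v; rewrite size_mkseq => lt E; rewrite nth_mkseq //; exact: HX E.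
    have /TTP H := HX (maxn z.+1 t); rewrite -(H z v) ?size_mkseq ?nth_mkseq //; try lia.
    by apply: run_mono E; lia.
- exists (fun z => if excluded_middle_informative (exists t v, run D t e z = v.+2)
                   then true else false) => z t v E.
  case: excluded_middle_informative => [[t' [v' E']]|nex].
    by have -> := run_det E E'.
  by case: v E => // v E; case: nex; exists t, v.
exists X, B; split=> // z v Ev; have [t Et] : exists t, run D t e z = v.+1.
  by apply: run_halts; exists psi.
exact: HX Et.
Qed.

(** [B] and [q] are fixed before [c]: a single total extension answers the questions for all trees
    at once, including those without a path. *)
Lemma uniform_paths (b d : tdegree) (R : nat -> seq nat -> bool) :
  (forall f l, cf f -> cfl l -> cfb (fun A x => R (f A x) (l A x))) ->
  unif_high_descending d -> PA_over b d ->
  exists B q, b B /\ forall c, (exists P, path_in R c P) ->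
    exists2 P, path_in R c P & forall n, eval B q (cpair c n) (P n).
Proof.
move=> cfbR [D [f [dD cof Hf]]] PA.
have [G HG] := eval_path_bound cfbR cof Hf.
have [psi Hpsi] := eval_verdict cfbR D G.
have [X [B [bB [eX HX] Xpsi]]] := PA_total_extension psi dD PA.
have [r Er Hr] : exists2 r, progcode r = eX & forall z, eval B r z (X z).
  have [r Er _] := HX 0; exists r => // z; have [r'] := HX z.
  by rewrite -Er => /progcode_inj ->.
have [a Ha] : cf (fun _ w => cpair (cfst (cfst w)) (cpair (csnd (cfst w)) (csnd w))) by cfs.
(* The next entry is the least [k] for which the oracle answers false at [<c, <s, k>>]. *)
have [p Hp] := eval_build_sequence (Mu (Comp Oracle a)).
have [out Hout] : cf (fun _ w => nth 0 (dec (csnd w)) (csnd (cfst w))) by cfs.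
have [i Hi] := cf_id; have [nx Hnx] : cf (fun _ w => cpair (cfst w) (csnd w).+1) by cfs.
exists B, (reoracle r (Comp out (Pair i (Comp p nx)))); split=> // c /HG [g Hg].
have [||P HP] := Hp X c (fun s => alive R c g s predT).
- move=> t; have [_ [P HP le]] := Hg t.+1; apply/negP => /deadP dd.
  suff lv : level R c (mkseq g t.+1) (mkseq P t.+1) by have := dd _ lv erefl.
  rewrite /level !size_mkseq eqxx good_path // andbT.
  by apply/boundedP => j; rewrite size_mkseq => lt; rewrite !nth_mkseq ?le.
- move=> s Hs; pose z k := cpair c (cpair (seqcode s) k).
  have [k|k Hk [Xk Xj]] := @alive_next R c g s (fun k => X (z k)) _ Hs.
    move=> ex; have [t Ht le] := Hpsi c g s k (fun n => (Hg n).1) ex.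
    by exists t; rewrite (Xpsi _ _ Ht); case: (verdict _ _ _ _ _) le => [|[]].
  exists k; last exact: alive_rcons.
  have Hz j : eval X (Comp Oracle a) (cpair (cpair c (seqcode s)) j) (X (z j)).
    apply: (ev_comp (y := z j)); last exact: ev_oracle.
    by have := Ha X (cpair (cpair c (seqcode s)) j); rewrite !(cfst_pair, csnd_pair).
  apply: (ev_mu (w := fun=> 0)) => [j lt|]; last by have := Hz k; rewrite Xk.
  by have := Hz j; rewrite (Xj j lt).
exists P => [m|n]; first by case: (HP m) => /alive_R.
apply: (eval_reoracle Hr); apply: (ev_comp (y := cpair (cpair c n) (seqcode (mkseq P n.+1)))).
  apply: ev_pair (Hi _ _) _; apply: (ev_comp (y := cpair c n.+1)); last by case: (HP n.+1).
  by have := Hnx X (cpair c n); rewrite cfst_pair csnd_pair.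
have := Hout X (cpair (cpair c n) (seqcode (mkseq P n.+1))).
by rewrite !(cfst_pair, csnd_pair) seqcodeK nth_mkseq.
Qed.

(** * Isomorphisms as paths *)

(* A path P codes a map F and its inverse G by P n = <F n, G n>.  The checks on a
   finite part s of P run the machines for [size s] steps only; this keeps them
   total, and each violation is still found eventually. *)
Definition map_check (i j : nat) (p1 p2 : nat -> nat) (s : seq nat) (x : nat) : bool :=
  (run emptyset (size s) i (cpair 0 x) == 2) ==>
    ((run emptyset (size s) j (cpair 0 (p1 (nth 0 s x))) != 1) &&
     ((p1 (nth 0 s x) < size s) ==> (p2 (nth 0 s (p1 (nth 0 s x))) == x))).

(** Because of the shift in [run], the value 2 means that membership is confirmed within [t]
    steps. *)
Definition in_dom (i t : nat) (xs : seq nat) : bool :=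
  all (fun l => run emptyset t i (cpair 0 (nth 0 xs l)) == 2) (iota 0 (size xs)).

Definition image (s xs : seq nat) : seq nat :=
  mkseq (fun l => cfst (nth 0 s (nth 0 xs l))) (size xs).

(** In [(size xs).+2] one successor comes from [arity_code] and the other from [run]. *)
Definition rel_check (i j : nat) (s : seq nat) (u : nat) (xs : seq nat) : bool :=
  let a := run emptyset (size s) i (cpair 3 (cpair u (seqcode xs))) in
  let b := run emptyset (size s) j (cpair 3 (cpair u (seqcode (image s xs)))) in
  [&& in_dom i (size s) xs, run emptyset (size s) i (cpair 1 u) == (size xs).+2,
      0 < a & 0 < b] ==> (a == b).

(** The guard [a <= size s] makes [a.-1] a position of [s], so that no default entry is
    consulted. *)
Definition fun_check (i j : nat) (s : seq nat) (u : nat) (xs : seq nat) : bool :=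
  let a := run emptyset (size s) i (cpair 4 (cpair u (seqcode xs))) in
  let b := run emptyset (size s) j (cpair 4 (cpair u (seqcode (image s xs)))) in
  [&& in_dom i (size s) xs, run emptyset (size s) i (cpair 2 u) == (size xs).+2,
      0 < a <= size s & 0 < b] ==> (cfst (nth 0 s a.-1) == b.-1).

Definition iso_check (c : nat) (s : seq nat) : bool :=
  all (fun x => map_check (cfst c) (csnd c) cfst csnd s x &&
                map_check (csnd c) (cfst c) csnd cfst s x) (iota 0 (size s)) &&
  all (fun u => all (fun a => rel_check (cfst c) (csnd c) s u (dec a) &&
                              fun_check (cfst c) (csnd c) s u (dec a))
                    (iota 0 (size s))) (iota 0 (size s)).

Lemma iso_checkP c s : reflect
  ((forall x, x < size s -> map_check (cfst c) (csnd c) cfst csnd s x /\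
      map_check (csnd c) (cfst c) csnd cfst s x) /\
   (forall u xs, u < size s -> seqcode xs < size s ->
      rel_check (cfst c) (csnd c) s u xs /\ fun_check (cfst c) (csnd c) s u xs))
  (iso_check c s).
Proof.
apply: (iffP andP) => -[H1 H2].
  split=> [x lt|u xs lu lx].
    by apply/andP; apply: (allP H1); rewrite mem_iota.
  apply/andP; rewrite -(seqcodeK xs).
  by apply: (allP ((allP H2) u _)); rewrite mem_iota.
split; apply/allP => x; rewrite mem_iota => lt; first exact/andP/H1.
by apply/allP => a; rewrite mem_iota => la; apply/andP/H2; rewrite ?decK.
Qed.

Lemma cfb_map_check f g p1 p2 l h : cf f -> cf g -> cf (fun _ => p1) -> cf (fun _ => p2) ->
  cfl l -> cf h ->
  cfb (fun A x => map_check (f A x) (g A x) p1 p2 (l A x) (h A x)).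
Proof.
move=> Hf Hg H1 H2 Hl Hh; rewrite /map_check.
by repeat (cfs; first [apply: cf_run0 | apply: (cf_comp H1) | apply: (cf_comp H2)]); cfs.
Qed.

Lemma cfb_in_dom f g l : cf f -> cf g -> cfl l ->
  cfb (fun A x => in_dom (f A x) (g A x) (l A x)).
Proof. by move=> Hf Hg Hl; rewrite /in_dom; cfs; apply: cf_run0; cfs. Qed.

Lemma cfb_rel_check f g l h r : cf f -> cf g -> cfl l -> cf h -> cfl r ->
  cfb (fun A x => rel_check (f A x) (g A x) (l A x) (h A x) (r A x)).
Proof.
move=> Hf Hg Hl Hh Hr; rewrite /rel_check /image.
by repeat (cfs; first [apply: cf_run0 | apply: cfb_in_dom]); cfs.
Qed.

Lemma cfb_fun_check f g l h r : cf f -> cf g -> cfl l -> cf h -> cfl r ->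
  cfb (fun A x => fun_check (f A x) (g A x) (l A x) (h A x) (r A x)).
Proof.
move=> Hf Hg Hl Hh Hr; rewrite /fun_check /image.
by repeat (cfs; first [apply: cf_run0 | apply: cfb_in_dom]); cfs.
Qed.

Lemma cfb_iso_check f l : cf f -> cfl l -> cfb (fun A x => iso_check (f A x) (l A x)).
Proof.
move=> Hf Hl; have H1 : cf (fun _ => cfst) := cf_fst cf_id.
have H2 : cf (fun _ => csnd) := cf_snd cf_id.
rewrite /iso_check; cfs.
- by apply: cfb_map_check; cfs.
- by apply: cfb_map_check; cfs.
- by apply: cfb_rel_check; cfs.
- by apply: cfb_fun_check; cfs.
Qed.

Lemma nth_lt_seqcode s l : l < size s -> nth 0 s l < seqcode s.
Proof.
elim: s l => [|x s IH] [|l] //= lt; first by have := cpair_spec x (seqcode s); nia.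
by have := IH l lt; have := cpair_ge_snd x (seqcode s); lia.
Qed.

Lemma in_domP i t M xs : st_listed i M -> in_dom i t xs -> all (sdom M) xs.
Proof.
case=> Hd _ _ _ _ /allP H; apply/(all_nthP 0) => l lt.
have /eqP E : run emptyset t i (cpair 0 (nth 0 xs l)) == 2.
  by apply: H; rewrite mem_iota.
by have := run_phi (Hd _) E; case: sdom.
Qed.

Lemma in_dom_eventually i M xs : st_listed i M -> all (sdom M) xs ->
  exists t0, forall t, t0 <= t -> in_dom i t xs.
Proof.
case=> Hd _ _ _ _; suff H : all (sdom M) xs -> exists t0, forall t, t0 <= t ->
    all (fun x => run emptyset t i (cpair 0 x) == 2) xs.
  move=> /H [t0 H0]; exists t0 => t /H0 /(all_nthP 0) Ht.
  by apply/allP => l; rewrite mem_iota => lt; apply: Ht.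
elim: xs => [|x xs IH] /=; first by exists 0.
case/andP => Hx /IH [t0 H0]; have := Hd x; rewrite Hx => /run_eventually [t1 H1].
exists (maxn t0 t1) => t; rewrite geq_max => /andP [l0 l1].
by rewrite (H1 t l1) H0.
Qed.

Lemma map_check_sound i j M N (p1 p2 : nat -> nat) (P : nat -> nat) m x :
  st_listed i M -> st_listed j N ->
  (forall x, sdom M x -> sdom N (p1 (P x)) /\ p2 (P (p1 (P x))) = x) ->
  x < m -> map_check i j p1 p2 (mkseq P m) x.
Proof.
case=> HM _ _ _ _ [HN _ _ _ _] H lt; rewrite /map_check size_mkseq nth_mkseq //.
apply/implyP => /eqP E; have Mx : sdom M x.
  by have := run_phi (HM x) E; case: sdom.
have [Ny Ex] := H x Mx; apply/andP; split.
  by apply/eqP => E'; have := run_phi (HN _) E'; rewrite Ny.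
by apply/implyP => lt'; rewrite nth_mkseq // Ex.
Qed.

Lemma map_check_complete i j M N (p1 p2 : nat -> nat) (P : nat -> nat) :
  st_listed i M -> st_listed j N ->
  (forall m x, x < m -> map_check i j p1 p2 (mkseq P m) x) ->
  forall x, sdom M x -> sdom N (p1 (P x)) /\ p2 (P (p1 (P x))) = x.
Proof.
case=> HM _ _ _ _ [HN _ _ _ _] H x Mx.
have := HM x; rewrite Mx => /run_eventually [t1 H1].
have [t2 H2] := run_eventually (HN (p1 (P x))).
(* At this length both membership computations have halted and both positions lie inside the
   segment. *)
pose m := maxn (maxn t1 t2) (maxn x (p1 (P x))).+1.
have lt : x < m by rewrite /m; lia.
have := H m x lt; rewrite /map_check size_mkseq nth_mkseq // H1 /=; last by rewrite /m; lia.
rewrite H2; last by rewrite /m; lia.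
have lt' : p1 (P x) < m by rewrite /m; lia.
rewrite lt' nth_mkseq //= => /andP [+ /eqP ->].
by case: (sdom N _).
Qed.

Lemma image_mkseq (P : nat -> nat) m xs : seqcode xs <= m ->
  image (mkseq P m) xs = map (fun x => cfst (P x)) xs.
Proof.
move=> le; apply: (@eq_from_nth _ 0) => [|l]; rewrite size_mkseq ?size_map // => lt.
rewrite nth_mkseq // (nth_map 0) // nth_mkseq //.
exact: leq_trans (nth_lt_seqcode lt) le.
Qed.

Lemma Forall2_map (h : nat -> nat -> Prop) (F : nat -> nat) xs :
  (forall x, x \in xs -> h x (F x)) -> List.Forall2 h xs (map F xs).
Proof.
elim: xs => [|x xs IH] H /=; constructor; first by apply: H; rewrite mem_head.
by apply: IH => y Hy; apply: H; rewrite inE Hy orbT.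
Qed.

Lemma isomorphism_path i j M N : st_listed i M -> st_listed j N -> isomorphic M N ->
  exists P, path_in iso_check (cpair i j) P.
Proof.
move=> LM LN [h [[Hr Hf] [hfun hdom hran hinj] hrel hfn]].
(* [F] and [G] are total choices from [h] and its converse; their values off the domains are
   arbitrary. *)
pose F x := epsilon (inhabits 0) (h x).
pose G y := epsilon (inhabits 0) (h^~ y).
have HF x : sdom M x -> h x (F x) by move=> /hdom; apply: epsilon_spec.
have HG y : sdom N y -> h (G y) y by move=> /hran; apply: (epsilon_spec _ (h^~ y)).
have FN x : sdom M x -> sdom N (F x) by move=> /HF H; apply/hran; exists x.
have GM y : sdom N y -> sdom M (G y) by move=> /HG H; apply/hdom; exists y.
exists (fun n => cpair (F n) (G n)) => m; apply/iso_checkP.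
rewrite cfst_pair csnd_pair size_mkseq; split=> [x lt|u xs lu lx].
  split; [apply: (map_check_sound LM LN)|apply: (map_check_sound LN LM)] => //.
    move=> y My; rewrite !(cfst_pair, csnd_pair); split; first exact: FN.
    by apply: hinj (HF y My); apply/HG/FN.
  move=> y Ny; rewrite !(cfst_pair, csnd_pair); split; first exact: GM.
  by apply: hfun (HG y Ny); apply/HF/GM.
have imE : image (mkseq (fun n => cpair (F n) (G n)) m) xs = map F xs.
  rewrite image_mkseq; last exact: ltnW.
  by apply: eq_map => x; rewrite cfst_pair.
have hxs : all (sdom M) xs -> List.Forall2 h xs (map F xs).
  by move=> /allP Mxs; apply: Forall2_map => x /Mxs/HF.
have Nxs : all (sdom M) xs -> all (sdom N) (map F xs).
  by move=> /allP Mxs; rewrite all_map; apply/allP => x /Mxs/FN.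
have [_ HMr HMf HMR HMF] := LM; have [_ _ _ HNR HNF] := LN.
rewrite /rel_check /fun_check imE size_mkseq; split.
  apply/implyP => /and4P [/(in_domP LM) dom /eqP Ea].
  case Ex: run => [//|v] _; case Ey: run => [//|v'] _.
  have arM : rel_arity (slang M) u = Some (size xs).
    by have := run_phi (HMr u) Ea; case: rel_arity => //= a [->].
  have -> := run_phi (HMR u xs arM dom) Ex.
  have -> := run_phi (HNR u (map F xs) _ (Nxs dom)) Ey.
    by rewrite (hrel u xs (map F xs)) //; apply: hxs.
  by rewrite -Hr size_map.
apply/implyP => /and4P [/(in_domP LM) dom /eqP Ea].
case Ex: run => [//|v] /= le; case Ey: run => [//|v'] _ /=.
have arM : fun_arity (slang M) u = Some (size xs).
  by have := run_phi (HMf u) Ea; case: fun_arity => //= a [->].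
have arN : fun_arity (slang N) u = Some (size (map F xs)) by rewrite -Hf size_map.
rewrite nth_mkseq // cfst_pair (run_phi (HMF u xs arM dom) Ex).
rewrite (run_phi (HNF u _ arN (Nxs dom)) Ey).
have h1 := hfn u xs (map F xs) arM (hxs dom).
by apply/eqP; apply: hfun h1; apply/HF/sfun_dom.
Qed.

(** Each condition is read off a segment so long that all computations involved have halted. The
    second components of [P] give the inverse, hence injectivity and surjectivity. *)
Lemma path_isomorphism i j M N P (h : nat -> nat -> Prop) :
  st_listed i M -> st_listed j N -> same_language (slang M) (slang N) ->
  path_in iso_check (cpair i j) P ->
  (forall x y, h x y <-> sdom M x /\ y = cfst (P x)) -> isomorphism h M N.
Proof.
move=> LM LN same HP hE.
have mapP m : _ := elimT (iso_checkP _ _) (HP m).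
have MN : forall x, sdom M x -> sdom N (cfst (P x)) /\ csnd (P (cfst (P x))) = x.
  apply: (map_check_complete LM LN) => m x lt.
  have [H _] := mapP m; move: H; rewrite cfst_pair csnd_pair size_mkseq => H.
  by case: (H x lt).
have NM : forall y, sdom N y -> sdom M (csnd (P y)) /\ cfst (P (csnd (P y))) = y.
  apply: (map_check_complete LN LM) => m x lt.
  have [H _] := mapP m; move: H; rewrite cfst_pair csnd_pair size_mkseq => H.
  by case: (H x lt).
have symP m u xs : u < m -> seqcode xs < m ->
    rel_check i j (mkseq P m) u xs /\ fun_check i j (mkseq P m) u xs.
  by have [_] := mapP m; rewrite cfst_pair csnd_pair size_mkseq; apply.
have hmap xs ys : List.Forall2 h xs ys ->
    all (sdom M) xs /\ ys = map (fun x => cfst (P x)) xs.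
  by elim=> //= x y xs' ys' /hE [-> ->] _ [-> ->].
have Nys xs : all (sdom M) xs -> all (sdom N) (map (fun x => cfst (P x)) xs).
  by move=> /allP H; rewrite all_map; apply/allP => x /H /MN [].
have [_ HMr HMf HMR HMF] := LM; have [_ HNr HNf HNR HNF] := LN.
split=> //.
- split.
  + by move=> x y y' /hE [_ ->] /hE [_ ->].
  + by move=> x; split=> [Mx|[y /hE []]] //; exists (cfst (P x)); apply/hE.
  + move=> y; split=> [/NM [My Ey]|[x /hE [/MN [Nx _] ->]]] //.
    by exists (csnd (P y)); apply/hE.
  + by move=> x x' y /hE [/MN [_ {2}<-] ->] /hE [/MN [_ {2}<-] ->].
- move=> u xs ys arM /hmap [Mxs ->].
  have arN : rel_arity (slang N) u = Some (size (map (fun x => cfst (P x)) xs)).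
    by rewrite -same.1 size_map.
  have [t1 H1] := in_dom_eventually LM Mxs.
  have [t2 H2] := run_eventually (HMr u).
  have [t3 H3] := run_eventually (HMR u xs arM Mxs).
  have [t4 H4] := run_eventually (HNR u _ arN (Nys _ Mxs)).
  pose m := maxn (maxn (maxn t1 t2) (maxn t3 t4)) (maxn u (seqcode xs)).+1.
  have lx : seqcode xs < m by rewrite /m; lia.
  have [+ _] := symP m u xs (ltac:(rewrite /m; lia)) lx.
  rewrite /rel_check image_mkseq ?(ltnW lx) // size_mkseq.
  rewrite H1 ?H2 ?H3 ?H4; try by rewrite /m; lia.
  by rewrite arM /= eqxx /= => /eqP []; do 2!case: (srel _ _ _).
- move=> u xs ys arM /hmap [Mxs ->].
  have arN : fun_arity (slang N) u = Some (size (map (fun x => cfst (P x)) xs)).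
    by rewrite -same.2 size_map.
  have [t1 H1] := in_dom_eventually LM Mxs.
  have [t2 H2] := run_eventually (HMf u).
  have [t3 H3] := run_eventually (HMF u xs arM Mxs).
  have [t4 H4] := run_eventually (HNF u _ arN (Nys _ Mxs)).
  pose m := maxn (maxn (maxn t1 t2) (maxn t3 t4))
    (maxn (maxn u (seqcode xs)) (sfun M u xs)).+1.
  have lx : seqcode xs < m by rewrite /m; lia.
  have [_ +] := symP m u xs (ltac:(rewrite /m; lia)) lx.
  rewrite /fun_check image_mkseq ?(ltnW lx) // size_mkseq.
  rewrite H1 ?H2 ?H3 ?H4; try by rewrite /m; lia.
  have lm : sfun M u xs < m by rewrite /m; lia.
  rewrite arM /= eqxx /= lm /= nth_mkseq // => /eqP E; apply/hE.
  by split; [apply: sfun_dom | rewrite E].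
Qed.

Theorem mainTheorem13 (d b : tdegree) :
  unif_high_descending d -> PA_over b d -> unif_high_isomorphism b.
Proof.
move=> Hd PA; have [B [q [bB Hq]]] := uniform_paths cfb_iso_check Hd PA.
have [i0 Hi] := cf_id.
have [test Htest] : cfb (fun _ w =>
    run emptyset (csnd w) (cfst (cfst (cfst w))) (cpair 0 (csnd (cfst w))) != 2).
  by cfs; apply: cf_run0; cfs.
(* the search [Mu test] only forces divergence outside the domain *)
pose p := Comp Fst (Comp q (Comp Fst (Pair i0 (Mu test)))).
have [sm Hsm] : cf (fun _ c => smn p c) by apply: cf_smn; cfs.
exists B, (smn p); split=> //.
  by exists (progcode sm) => x; exists sm.
move=> i j M N LM LN iso; have [P HP Pq] := Hq _ (isomorphism_path LM LN iso).
have same : same_language (slang M) (slang N) by case: iso => h [].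
apply: (path_isomorphism LM LN same HP) => x y.
pose c := cpair i j; have [HM _ _ _ _] := LM.
have Ht t : eval B test (cpair (cpair c x) t) (run emptyset t i (cpair 0 x) != 2).
  have := Htest B (cpair (cpair c x) t).
  by rewrite !(cfst_pair, csnd_pair).
have fwd : sdom M x -> eval B p (cpair c x) (cfst (P x)).
  move=> Mx; have := HM x; rewrite Mx => /run_halts [t0 E0].
  have [t|/=|t Et _] := eval_mu_least (A := B) (p := test) (a := cpair c x) (n := t0)
    (f := fun t => nat_of_bool (run emptyset t i (cpair 0 x) != 2)); first exact: Ht.
    by rewrite E0.
  apply: ev_comp (ev_fst _ _); apply: ev_comp (Pq x).
  apply: ev_comp (ev_pair (Hi B (cpair c x)) Et) _.
  by rewrite -{2}(cfst_pair (cpair c x) t); apply: ev_fst.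
split=> [/eval_smn H|[/fwd Hx ->]]; last exact/eval_smn.
(* Inverting the computation of [p] exposes a successful search, whose result is a time at which [x]
   is confirmed to lie in the domain. *)
suff Mx : sdom M x by split=> //; apply: eval_det H (fwd Mx).
inversion H as [| | | | | |? ? ? ? ? H1 _| | |]; subst.
inversion H1 as [| | | | | |? ? ? ? ? H2 _| | |]; subst.
inversion H2 as [| | | | | |? ? ? ? ? H3 _| | |]; subst.
inversion H3 as [| | | | |? ? ? ? ? _ H4| | | |]; subst.
inversion H4 as [| | | | | | | | |? ? ? ? _ H5]; subst.
have /eqP := eval_det H5 (Ht z); rewrite eq_sym eqb0 negbK => /eqP E.
by have := run_phi (HM x) E; case: sdom.
Qed.
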